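(* There exist positive real universal constants $A$, $B_1$, $B_2$, $B_3$ and $B_4$ such that for any positive real constants $\alpha>1$, $d$ and $\delta\neq1$, and any prior distribution $\pi\in\mathcal M_+^1(\Theta)$, with $\mathbb P$ probability at least $1-\epsilon$ the following holds for any $\beta,\gamma\in\Lambda_\alpha$ such that $$\sup_{\beta'\in\mathbb R,\,\beta'\ge\beta}\Bigl|\frac{\beta'}{d}\bigl[\pi_{\exp(-\beta'R)}(R)-\inf_\Theta R\bigr]-1\Bigr|\le\delta$$ and such that also, for some positive real parameter $x$, $$\frac{\gamma\max\{x,1\}}{N}\le\frac{A\beta}{\gamma}\quad\text{and}\quad\frac{\beta}{\gamma}\le\frac{B_1}{B_2\frac{(1+\delta)}{(1-\delta)}+\dfrac{B_4\frac{\gamma^2}{N}\varphi(x)-2B_3\log(\epsilon)+4B_3\log\bigl[\frac{\log(N)}{\log(\alpha)}\bigr]}{(1-\delta)d}}:$$ the bound $B(\pi_{\exp(-\frac\gamma2r)},\beta,\gamma)$ defined in the context, with $\nu$ chosen to be the uniform probability measure on $\Lambda_\alpha$, satisfies $$B(\pi_{\exp(-\frac\gamma2r)},\beta,\gamma)\le0,$$ proving that $\widehat\beta(\pi_{\exp(-\frac\gamma2r)})\ge\beta$ and therefore that $$\pi_{\exp(-\gamma\frac r2)}(R)\le\pi_{\exp(-\beta R)}(R)\le\inf_\Theta R+\frac{(1+\delta)d}{\beta}.$$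
   Context: Setting. $N\ge 1$ is an integer, $(\mathcal X,\mathcal B)$ a measurable space, $\mathcal Y$ a finite set with the algebra of all its subsets, $\Omega=(\mathcal X\times\mathcal Y)^N$ with coordinate process $(X_i,Y_i)_{i=1}^N$, and $\mathbb P=\bigotimes_{i=1}^N P_i$ a product of arbitrary (not necessarily identical) probability measures on $\mathcal X\times\mathcal Y$. $(\Theta,\mathcal T)$ is a measurable space and $(\theta,x)\mapsto f_\theta(x)\in\mathcal Y$ is measurable on $\Theta\times\mathcal X$. All $\sigma$-algebras are countably generated. Put $$r(\theta)=\frac1N\sum_{i=1}^N\mathbf 1[f_\theta(X_i)\ne Y_i],\qquad R(\theta)=\frac1N\sum_{i=1}^N\mathbb P[f_\theta(X_i)\ne Y_i],$$ $$m'(\theta,\theta')=\frac1N\sum_{i=1}^N\bigl|\mathbf 1[f_\theta(X_i)\ne Y_i]-\mathbf 1[f_{\theta'}(X_i)\ne Y_i]\bigr|,\qquad M'(\theta,\theta')=\mathbb P[m'(\theta,\theta')].$$ It is assumed that there is $\widetilde\theta\in\Theta$ with $R(\widetilde\theta)=\inf_\Theta R$; the (expected) margin function is $$\varphi(x)=\sup_{\theta\in\Theta}M'(\theta,\widetilde\theta)-x\bigl[R(\theta)-R(\widetilde\theta)\bigr],\quad x\in\mathbb R_+.$$ $\epsilon\in(0,1)$, and $\Lambda_\alpha=\{\alpha^k;\ k\in\mathbb N,\ 0\le k<\frac{\log N}{\log\alpha}\}$. $\mathcal M_+^1(E)$ is the set of probability measures on $E$; $\mu(h)=\int h\,d\mu$;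 for a probability measure $\rho$ on $\Theta$, $\rho(m')$ denotes the function $\theta'\mapsto\int m'(\theta,\theta')\rho(d\theta)$. A posterior distribution is a regular conditional probability measure $\rho:\Omega\to\mathcal M_+^1(\Theta)$; a prior does not depend on the sample. $\mathcal K(\rho,\pi)=\int\log(d\rho/d\pi)\,d\rho$ if $\rho\ll\pi$, $+\infty$ otherwise. For bounded measurable $h$, $d\pi_{\exp(h)}/d\pi=\exp(h)/\pi[\exp(h)]$. Empirical bound. For real $\alpha'$ and $\gamma>0$, $F_{\gamma,\alpha'}(x)=-N\log[1-\tanh(\tfrac\gamma N)x]-\alpha' x$; when $\alpha'<N\tanh(\gamma/N)$ and $y\ge0$, $F_{\gamma,\alpha'}^{-1}(y)$ is the unique $x\in[0,\tanh(\gamma/N)^{-1})$ with $F_{\gamma,\alpha'}(x)=y$. For an atomic probability measure $\nu$ on $\mathbb R_+$, writing $\nu(\beta)=\nu(\{\beta\})$, for $\beta,\gamma>0$, $$\begin{aligned}B(\rho,\beta,\gamma)=\inf\Bigl\{&\mathcal K\bigl[\rho,\pi_{\exp(-\lambda_1 r)}\bigr]+(\gamma-\lambda_1)\bigl[\rho(r)-\pi_{\exp(-\lambda_2 r)}(r)\bigr]\\&+\log\Bigl\{\pi_{\exp(-\lambda_1 r)}\Bigl[\exp\bigl\{N\log[\cosh(\tfrac{\gamma}{N})]\,\rho(m')\bigr\}\Bigr]\Bigr\}-\log\bigl[\epsilon\,\nu(\beta)\nu(\gamma)\bigr]\\&+(\gamma-\lambda_1)\tfrac{\beta}{\lambda_2}F^{-1}_{\gamma,\frac{\beta\gamma}{\lambda_2}}\Bigl[\log\Bigl\{\pi_{\exp(-\lambda_2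 r)}\Bigl[\exp\bigl\{N\log[\cosh(\tfrac{\gamma}{N})]\,\pi_{\exp(-\lambda_2 r)}(m')\bigr\}\Bigr]\Bigr\}-\log\bigl[\epsilon\,\nu(\beta)\nu(\gamma)\bigr]\Bigr]\Bigr\},\end{aligned}$$ the infimum being over $\lambda_1\in\mathbb R_+$, $\lambda_1\le\gamma$ and $\lambda_2>\frac{\beta\gamma}{N}\tanh(\frac\gamma N)^{-1}$; $B(\rho,\beta,\gamma)=+\infty$ when $\nu(\beta)=0$ or $\nu(\gamma)=0$. Finally $\widehat\beta(\rho)=\sup\{\beta\in\mathbb R;\ \inf_{\gamma:\,N\tanh(\gamma/N)>\beta}B(\rho,\beta,\gamma)\le0\}$.
   Formalization: The hypothesis α ≤ N is added: for α > N ≥ 2 the grid Λ_α is {1} and B ≥ −log ε > 0 always, while the premises can still be met because log[log(N)/log(α)] tends to −∞ as α grows, so the claim as stated fails there. *)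

(* Defs.v *)
From HB Require Import structures.
From mathcomp Require Import all_boot all_order all_algebra finmap.
From mathcomp Require Import all_classical all_reals all_analysis measurable_realfun.
Set Implicit Arguments.
Unset Strict Implicit.
Unset Printing Implicit Defensive.
Import Order.TTheory GRing.Theory Num.Theory.
Import numFieldNormedType.Exports.
Local Open Scope classical_set_scope.
Local Open Scope ring_scope.

Section hyperbolic.
Context {R : realType}.
Implicit Types x : R.

Definition cosh x : R := (expR x + expR (- x)) / 2.
Definition tanh x : R := (expR x - expR (- x)) / (expR x + expR (- x)).

End hyperbolic.

Definition countably_generated d (T : measurableType d) : Prop :=
  exists G : set (set T), countable G /\ (measurable : set (set T)) = <<s G >>.

(* The family of measurable rectangles is a generating pi-system, so [mu] is
   the product of the [P i] iff it satisfies the product rule on rectangles. *)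
Definition is_product_measure d (T : measurableType d) (R : realType) (N : nat)
    (P : 'I_N -> probability T R) (mu : probability (N.-tuple T) R) : Prop :=
  forall A : 'I_N -> set T, (forall i, measurable (A i)) ->
    mu [set w | forall i, A i (tnth w i)] = (\prod_(i < N) P i (A i))%E.

Section gibbs.
Context d (T : measurableType d) (R : realType).
Local Open Scope ereal_scope.

Section exp_density.
Context (pi : probability T R) (h : T -> R)
  (mh : measurable_fun [set: T] h).

(* The vacuous [let] makes [mh] an argument, as the measure instance needs it. *)
Definition exp_density (A : set T) : \bar R :=
  let _ := mh in \int[pi]_(t in A) (expR (h t))%:E.

Let mexp : measurable_fun [set: T] (EFin \o (expR \o h)).
Proof. by apply/measurable_EFinP; exact: measurableT_comp. Qed.

Let exp_density0 : exp_density set0 = 0.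
Proof. by rewrite /exp_density integral_set0. Qed.

Let exp_density_ge0 A : 0 <= exp_density A.
Proof. by apply: integral_ge0 => t _; rewrite lee_fin expR_ge0. Qed.

Let exp_density_sigma_additive : semi_sigma_additive exp_density.
Proof.
move=> F mF tF mUF; rewrite /exp_density ge0_integral_bigcup//.
- apply: is_cvg_ereal_nneg_natsum => n _.
  exact: exp_density_ge0.
- exact: measurable_funS mexp.
Qed.

HB.instance Definition _ := isMeasure.Build _ _ _ exp_density
  exp_density0 exp_density_ge0 exp_density_sigma_additive.

End exp_density.

(* [gibbs pi h] is pi_{exp(h)}.  The fallback value [pi] is taken only when [h]
   is not measurable or [exp h] is not integrable. *)
Definition gibbs (pi : probability T R) (h : T -> R) : probability T R :=
  match pselect (measurable_fun [set: T] h) with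
  | left mh => mnormalize (exp_density pi mh) pi
  | right _ => pi
  end.

Definition KL (rho pi : probability T R) : \bar R :=
  if `[< rho `<< pi >] then
    \int[rho]_t lne (Radon_Nikodym (charge_of_finite_measure rho) pi t)
  else +oo.

End gibbs.

(* For finite nonempty [L]; otherwise a junk Dirac mass. *)
Definition uniform_on (R : realType) (L : set R) :
    probability (measurableTypeR R) R :=
  mnormalize
    (msum (fun k => \d_(nth 0 (fset_set L) k : measurableTypeR R))
      #|` fset_set L|)
    \d_(0 : measurableTypeR R).

Definition grid (R : realType) (N : nat) (alpha : R) : set R :=
  [set alpha ^+ k | k in [set k : nat | k%:R < ln N%:R / ln alpha]].

Section classification.
Context dX (X : measurableType dX) dY (Y : measurableType dY)
  dT (Theta : measurableType dT) (R : realType) (N : nat).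
Context (f : Theta -> X -> Y).

Definition err (theta : Theta) (z : X * Y) : R :=
  \1_[set z : X * Y | f theta z.1 <> z.2] z.

Definition emp_risk (w : N.-tuple (X * Y)) (theta : Theta) : R :=
  N%:R^-1 * \sum_(i < N) err theta (tnth w i).

Definition emp_dist (w : N.-tuple (X * Y)) (theta theta' : Theta) : R :=
  N%:R^-1 * \sum_(i < N) `|err theta (tnth w i) - err theta' (tnth w i)|.

Section expected.
Context (P : probability (N.-tuple (X * Y)) R).

Definition risk (theta : Theta) : R :=
  N%:R^-1 * \sum_(i < N)
    fine (P [set w | f theta (tnth w i).1 <> (tnth w i).2]).

Definition exp_dist (theta theta' : Theta) : R :=
  \int[P]_w emp_dist w theta theta'.

Definition margin (theta0 : Theta) (x : R) : R :=
  sup [set exp_dist theta theta0 - x * (risk theta - risk theta0) |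
       theta in [set: Theta]].

End expected.

(* F_{gamma, a}; [Fga_inv] is its inverse on [0, tanh(gamma/N)^-1), which is
   single-valued when a < N tanh(gamma/N) and 0 <= y. *)
Definition Fga (gamma a x : R) : R :=
  - N%:R * ln (1 - tanh (gamma / N%:R) * x) - a * x.

Definition Fga_inv (gamma a y : R) : R :=
  xget 0 [set x | 0 <= x < (tanh (gamma / N%:R))^-1 /\ Fga gamma a x = y].

Section empirical_bound.
Context (pi : probability Theta R) (nu : probability (measurableTypeR R) R)
  (eps : R) (w : N.-tuple (X * Y)).

Let r := emp_risk w.
Let pi_r (lambda : R) := gibbs pi (fun theta => - (lambda * r theta)).
Let atom (b : R) : R := fine (nu [set b]).

(* log pi_{exp(-lambda r)}[exp{N log(cosh(gamma/N)) rho(m')}] *)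
Definition log_dist_moment (rho : probability Theta R) (gamma lambda : R) : R :=
  ln (\int[pi_r lambda]_theta'
        expR (N%:R * ln (cosh (gamma / N%:R)) *
              \int[rho]_theta emp_dist w theta theta')).

(* [Bfun] is +oo outside of beta, gamma > 0. *)
Definition Bfun (rho : probability Theta R) (beta gamma : R) : \bar R :=
  if [&& 0 < beta, 0 < gamma, atom beta != 0 & atom gamma != 0] then
    ereal_inf
      [set (KL rho (pi_r l.1) +
            ((gamma - l.1) *
               (\int[rho]_theta r theta - \int[pi_r l.2]_theta r theta)
             + log_dist_moment rho gamma l.1
             - ln (eps * atom beta * atom gamma)
             + (gamma - l.1) * (beta / l.2) *
               Fga_inv gamma (beta * gamma / l.2)
                 (log_dist_moment (pi_r l.2) gamma l.2
                  - ln (eps * atom beta * atom gamma)))%:E)%E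
      | l in [set l : R * R | 0 <= l.1 <= gamma /\
                 beta * gamma / N%:R * (tanh (gamma / N%:R))^-1 < l.2]]
  else +oo%E.

Definition beta_hat (rho : probability Theta R) : \bar R :=
  ereal_sup
    [set beta%:E | beta in
      [set beta : R |
        (ereal_inf [set Bfun rho beta gamma | gamma in
           [set gamma : R | (beta < N%:R * tanh (gamma / N%:R))%R]] <= 0)%E]].

End empirical_bound.

End classification.

(* Main.v *)
Require Import Defs.
From HB Require Import structures.
From mathcomp Require Import all_boot all_order all_algebra finmap.
From mathcomp Require Import all_classical all_reals all_analysis measurable_realfun.
From mathcomp Require Import ring lra.
Set Implicit Arguments.
Unset Strict Implicit.
Unset Printing Implicit Defensive.
Import Order.TTheory GRing.Theory Num.Theory.
Import numFieldNormedType.Exports.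
Local Open Scope classical_set_scope.
Local Open Scope ring_scope.

(** Write [r'] and [R'] for the excesses of the empirical and expected risks
    over those of the minimiser [th0], and [m'], [M'] for the empirical and
    expected distances to [th0]. Put [Q b] for the Gibbs measure at
    temperature [b] of the expected risk and [rho b] for that of the empirical
    risk.

    The hypothesis says that the mean of [R'] under [Q b] lies between
    [(1 - delta) * d / b] and [(1 + delta) * d / b] for every [b >= beta], and
    that [gamma / beta * ((1 - delta) * d)] dominates a large multiple of
    [(1 + delta) * d + gamma ^ 2 / N * phi(x) - ln eps + ln (ln N / ln alpha)].
    Choosing [gamma / 2] and [2 * beta] as the two free parameters, the
    divergence term of the bound vanishes and the leading term becomes
    [gamma / 2] times the difference of the means of [r'] under
    [rho (gamma / 2)] and under [rho (2 * beta)]. The first mean is at most of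
    the order of the sum above divided by [gamma]; the second is at least of
    the order of [(1 - delta) * d / beta], up to the same error. So the
    difference is negative, and large enough to absorb all the other terms.

    To transfer the information from [R'] to [r'] one uses exponential
    moments. For a fixed parameter, [s * (r' - R') + a * m' - 3 * a * M'] has
    exponential moment at most one ([deviation_expR_le1]); by Fubini and
    Markov the same holds, up to the factor [6 * n ^ 2 / eps], for its mixture
    under any fixed [Q b], outside an exceptional event ([mixture_markov]).
    Six such events for each of the [n ^ 2] pairs of grid points have total
    probability at most [eps] ([good_event]).

    On the good event everything is deterministic. Since [rho l] has density
    proportional to [exp (- g)] with respect to [Q b], where
    [g = l * r' - b * R'], Jensen's inequality bounds the logarithm of
    [rho l (exp h)] by the logarithm of [Q b (exp (h - g))] plus the mean of
    [g] under [Q b] ([gibbs_ln_expR_le]). The distance [M'] is at most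
    [phi(x) + x * R'], and the smallness of [gamma ^ 2 * x / N] compared with
    [beta] lets the term in [R'] be absorbed by the gap between [l] and [b].
    With [b < l] this gives upper bounds ([posterior_ln_expR_le]) for the
    means of [r'] and [R'] and for the exponential moments of [m'] that enter
    the bound ([log_dist_moment_le]). With [b > l] it gives the lower bound
    for the mean of [r'] under [rho (2 * beta)] ([posterior_excess_ge]).
    [Bfun_le0] collects these estimates. The comparison of [rho (gamma / 2)]
    with [Q beta] for the expected risk follows in the same way, from the
    upper bound for the mean of [R'] under [rho (gamma / 2)]. *)

(** * Bounded measurable functions *)

(** For such functions every integral against a probability measure is finite,
    so that integration is linear and monotone without further side
    conditions. *)
Definition bounded_measurable d (T : measurableType d) (R : realType)
    (h : T -> R) : Prop :=
  measurable_fun [set: T] h /\ exists M : R, forall t, `|h t| <= M.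

Section bounded_measurable.
Context d (T : measurableType d) (R : realType).
Implicit Types (h g : T -> R) (mu : probability T R).

Lemma bm_cst (c : R) : bounded_measurable (fun _ : T => c).
Proof. by split; [exact: measurable_cst|exists `|c|]. Qed.

Lemma bmD h g : bounded_measurable h -> bounded_measurable g ->
  bounded_measurable (fun t => h t + g t).
Proof.
move=> [mh [M hM]] [mg [L gL]]; split; first exact: measurable_funD.
by exists (M + L) => t; rewrite (le_trans (ler_normD _ _))// lerD.
Qed.

Lemma bmN h : bounded_measurable h -> bounded_measurable (fun t => - h t).
Proof.
move=> [mh [M hM]]; split; first exact: measurableT_comp.
by exists M => t; rewrite normrN.
Qed.

Lemma bmB h g : bounded_measurable h -> bounded_measurable g ->
  bounded_measurable (fun t => h t - g t).
Proof. by move=> bh bg; apply: bmD => //; exact: bmN. Qed.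

Lemma bmM h g : bounded_measurable h -> bounded_measurable g ->
  bounded_measurable (fun t => h t * g t).
Proof.
move=> [mh [M hM]] [mg [L gL]]; split; first exact: measurable_funM.
by exists (M * L) => t; rewrite normrM ler_pM.
Qed.

Lemma bmZ c h : bounded_measurable h -> bounded_measurable (fun t => c * h t).
Proof. by move=> bh; apply: bmM => //; exact: bm_cst. Qed.

Lemma bm_expR h : bounded_measurable h ->
  bounded_measurable (fun t => expR (h t)).
Proof.
move=> [mh [M hM]]; split; first exact: measurableT_comp.
exists (expR M) => t; rewrite ger0_norm ?expR_ge0// ler_expR.
exact: le_trans (ler_norm _) (hM t).
Qed.

Lemma bm_integrable mu h : bounded_measurable h ->
  mu.-integrable [set: T] (EFin \o h).
Proof.
move=> [mh [M hM]]; apply: measurable_bounded_integrable => //.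
  exact/fin_num_fun_lty/fin_num_measure.
exists M; split; first exact: num_real.
by move=> x Mx t _; exact: le_trans (hM t) (ltW Mx).
Qed.

Lemma RintD mu h g : bounded_measurable h -> bounded_measurable g ->
  \int[mu]_t (h t + g t) = \int[mu]_t h t + \int[mu]_t g t.
Proof. by move=> bh bg; rewrite RintegralD//; exact: bm_integrable. Qed.

Lemma RintZ mu c h : bounded_measurable h ->
  \int[mu]_t (c * h t) = c * \int[mu]_t h t.
Proof. by move=> bh; rewrite RintegralZl//; exact: bm_integrable. Qed.

Lemma RintN mu h : bounded_measurable h ->
  \int[mu]_t (- h t) = - \int[mu]_t h t.
Proof.
move=> bh; rewrite -mulN1r -RintZ//.
by apply: eq_Rintegral => t _; rewrite mulN1r.
Qed.

Lemma RintB mu h g : bounded_measurable h -> bounded_measurable g ->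
  \int[mu]_t (h t - g t) = \int[mu]_t h t - \int[mu]_t g t.
Proof. by move=> bh bg; rewrite RintegralB//; exact: bm_integrable. Qed.

Lemma Rint_cst mu c : \int[mu]_(_ in [set: T]) c = c.
Proof. by rewrite Rintegral_cst// [X in fine X]probability_setT mulr1. Qed.

Lemma le_Rint mu h g : bounded_measurable h -> bounded_measurable g ->
  (forall t, h t <= g t) -> \int[mu]_t h t <= \int[mu]_t g t.
Proof.
by move=> bh bg hg; apply: le_Rintegral => //; exact: bm_integrable.
Qed.

Lemma Rint_expR_gt0 mu h : bounded_measurable h ->
  0 < \int[mu]_t expR (h t).
Proof.
move=> bh; have [_ [M hM]] := bh.
apply: (@lt_le_trans _ _ (expR (- M))); first exact: expR_gt0.
rewrite -[leLHS](Rint_cst mu); apply: le_Rint => //.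
- exact: bm_cst.
- exact: bm_expR.
by move=> t; rewrite ler_expR; have := hM t; rewrite ler_norml => /andP[].
Qed.

(** Jensen's inequality for [expR], read off its tangent line at the mean. *)
Lemma Rint_le_ln_expR mu h : bounded_measurable h ->
  \int[mu]_t h t <= ln (\int[mu]_t expR (h t)).
Proof.
move=> bh; set m := \int[mu]_t h t.
rewrite -[leLHS]expRK ler_ln ?posrE ?expR_gt0 ?Rint_expR_gt0//.
have be := bm_expR bh.
have -> : expR m = \int[mu]_t (expR m * (1 + (h t - m))).
  have bhm : bounded_measurable (fun t => h t - m).
    by apply: bmB => //; exact: bm_cst.
  rewrite RintZ; last by apply: bmD => //; exact: bm_cst.
  rewrite RintD//; last exact: bm_cst.
  rewrite RintB//; last exact: bm_cst.
  by rewrite !Rint_cst subrr addr0 mulr1.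
apply: le_Rint => //.
  by apply: bmZ; apply: bmD; [exact: bm_cst|apply: bmB => //; exact: bm_cst].
move=> t; rewrite -[in leRHS](subrK m (h t)) expRD mulrC.
by rewrite ler_pM2r ?expR_gt0// expR_ge1Dx.
Qed.

(** Convexity of [expR] between [0] and [h - K] lets a bound on one exponential
    moment pass to smaller powers with a proportional constant. *)
Lemma Rint_expR_scale_le mu h (K tau : R) : bounded_measurable h ->
  \int[mu]_t expR (h t) <= expR K -> 0 <= tau <= 1 ->
  \int[mu]_t expR (tau * h t) <= expR (tau * K).
Proof.
move=> bh hK /andP[t0 t1].
have conv (u : R) : expR (tau * u) <= tau * expR u + (1 - tau).
  (* Average the tangent lines of [expR] at [tau * u], evaluated at [u] and
     [0]. *)
  have e1 : expR u = expR (tau * u) * expR ((1 - tau) * u).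
    by rewrite -expRD; congr expR; ring.
  have e2 : 1 = expR (tau * u) * expR (- (tau * u)) :> R.
    by rewrite expRxMexpNx_1.
  have := expR_ge1Dx ((1 - tau) * u); have := expR_ge1Dx (- (tau * u)).
  have := expR_gt0 (tau * u).
  move: e1 e2; set p := expR (tau * u); set q := expR u.
  set v := expR (- _); set z := expR (_ * u) => -> e2 p0 v1 z1.
  have -> : 1 - tau = (1 - tau) * (p * v) by rewrite -e2 mulr1.
  rewrite -subr_ge0 (_ : _ - _ = p * (tau * (z - (1 + (1 - tau) * u)) +
    (1 - tau) * (v - (1 + - (tau * u))))); last by ring.
  by rewrite mulr_ge0 ?(ltW p0)// addr_ge0// mulr_ge0// subr_ge0.
have -> : \int[mu]_t expR (tau * h t) =
    \int[mu]_t (expR (tau * K) * expR (tau * (h t - K))).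
  by apply: eq_Rintegral => t _; rewrite -expRD; congr expR; ring.
have bK : bounded_measurable (fun t => h t - K).
  by apply: bmB => //; exact: bm_cst.
rewrite RintZ; last by apply: bm_expR; exact: bmZ.
rewrite -[leRHS]mulr1 ler_pM2l ?expR_gt0//.
apply: (@le_trans _ _ (\int[mu]_t (tau * expR (h t - K) + (1 - tau)))).
  apply: le_Rint => //; first by apply: bm_expR; exact: bmZ.
  by apply: bmD; [apply: bmZ; exact: bm_expR|exact: bm_cst].
rewrite RintD; [|by apply: bmZ; exact: bm_expR|exact: bm_cst].
rewrite Rint_cst RintZ; last exact: bm_expR.
suff : \int[mu]_t expR (h t - K) <= 1 by nra.
have -> : \int[mu]_t expR (h t - K) = \int[mu]_t (expR (- K) * expR (h t)).
  by apply: eq_Rintegral => t _; rewrite -expRD addrC.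
rewrite RintZ; last exact: bm_expR.
by rewrite expRN mulrC ler_pdivrMr ?expR_gt0// mul1r.
Qed.

End bounded_measurable.

Lemma bm_comp d1 d2 (S : measurableType d1) (T : measurableType d2)
    (R : realType) (h : T -> R) (phi : S -> T) :
  bounded_measurable h -> measurable_fun [set: S] phi ->
  bounded_measurable (h \o phi).
Proof.
move=> [mh [M hM]] mphi; split; first exact: measurableT_comp.
by exists M => t /=.
Qed.

Lemma bm_sum d (T : measurableType d) (R : realType) (I : Type) (s : seq I)
    (h : I -> T -> R) : (forall i, bounded_measurable (h i)) ->
  bounded_measurable (fun t => \sum_(i <- s) h i t).
Proof.
move=> bh; elim: s => [|i s IHs].
  by under eq_fun do rewrite big_nil; exact: bm_cst.
by under eq_fun do rewrite big_cons; exact: bmD.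
Qed.

Lemma bm_normr d (T : measurableType d) (R : realType) (h : T -> R) :
  bounded_measurable h -> bounded_measurable (fun t => `|h t|).
Proof.
move=> [mh [M hM]]; split; first exact: measurableT_comp.
by exists M => t; rewrite normr_id.
Qed.

Lemma Rint_EFin d (T : measurableType d) (R : realType) (mu : probability T R)
    (h : T -> R) : bounded_measurable h ->
  (\int[mu]_t (h t)%:E)%E = (\int[mu]_t h t)%:E.
Proof.
move=> bh; rewrite /Rintegral fineK//; apply: integrable_fin_num => //.
exact: bm_integrable.
Qed.

Section sections.
Context d1 d2 (T1 : measurableType d1) (T2 : measurableType d2) (R : realType).
Implicit Types h : T1 -> T2 -> R.

Lemma bm_section1 h x : bounded_measurable (fun p : T1 * T2 => h p.1 p.2) ->
  bounded_measurable (h x).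
Proof. by move=> bh; exact: bm_comp bh (pair1_measurable x). Qed.

Lemma bm_section2 h y : bounded_measurable (fun p : T1 * T2 => h p.1 p.2) ->
  bounded_measurable (h ^~ y).
Proof. by move=> bh; exact: bm_comp bh (pair2_measurable y). Qed.

Lemma bm_Rint (mu : probability T2 R) h :
  bounded_measurable (fun p : T1 * T2 => h p.1 p.2) ->
  (forall x y, 0 <= h x y) ->
  bounded_measurable (fun x => \int[mu]_y h x y).
Proof.
move=> bh h0; have [mh [M hM]] := bh; split; last first.
  exists M => x; rewrite ger0_norm; last by apply: Rintegral_ge0 => *.
  rewrite -[leRHS](Rint_cst mu).
  apply: le_Rint; [exact: bm_section1|exact: bm_cst|].
  by move=> y; exact: le_trans (ler_norm _) (hM (x, y)).
apply: measurableT_comp => //.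
apply: (measurable_fun_fubini_tonelli_F (fun p : T1 * T2 => (h p.1 p.2)%:E)).
  exact/measurable_EFinP.
by move=> p; rewrite lee_fin.
Qed.

End sections.

(** * Gibbs measures *)

Section gibbs_measure.
Context d (T : measurableType d) (R : realType) (pi : probability T R).
Implicit Types (h g k : T -> R).

Lemma gibbs_density h A : bounded_measurable h -> measurable A ->
  gibbs pi h A =
  (\int[pi]_(t in A) ((expR (h t) / \int[pi]_s expR (h s))%:E))%E.
Proof.
move=> bh mA; have Z0 := Rint_expR_gt0 pi bh.
have [mh _] := bh; rewrite /gibbs; case: pselect => // mh'.
have ZE : (\int[pi]_t (expR (h t))%:E)%E = (\int[pi]_s expR (h s))%:E.
  rewrite /Rintegral fineK//; apply: integrable_fin_num => //.
  exact/bm_integrable/bm_expR.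
rewrite /= /mnormalize /= /exp_density ZE eqe gt_eqF//=.
under [RHS]eq_integral do rewrite EFinM.
rewrite ge0_integralZr//.
- apply/measurable_EFinP/measurable_funTS.
  by case: (bm_expR bh).
- by rewrite lee_fin invr_ge0 ltW.
Qed.

Lemma gibbs_dominates h : bounded_measurable h -> gibbs pi h `<< pi.
Proof.
move=> bh; apply/null_content_dominatesP => A mA A0; rewrite gibbs_density//.
by rewrite null_set_integral//; apply/measurable_funTS/measurable_EFinP;
  case: (bmM (bm_expR bh) (bm_cst T (\int[pi]_s expR (h s))^-1)).
Qed.

(** The Gibbs measure is the one with density [expR h] relative to [pi], up to
    normalisation, so its expectations are ratios of expectations under [pi]. *)
Lemma gibbs_Rint h k : bounded_measurable h -> bounded_measurable k ->
  \int[gibbs pi h]_t k t =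
  (\int[pi]_t (expR (h t) * k t)) / \int[pi]_t expR (h t).
Proof.
move=> bh bk; set Z := \int[pi]_t expR (h t).
have bd := bmM (bm_expR bh) (bm_cst T Z^-1).
have bg := gibbs_dominates bh.
have ae : ae_eq pi [set: T]
    (Radon_Nikodym (charge_of_finite_measure (gibbs pi h)) pi)
    (fun t => (expR (h t) * Z^-1)%:E).
  apply: integral_ae_eq => //.
  - exact: Radon_Nikodym_integrable.
  - by apply/measurable_EFinP; case: bd.
  - move=> A _ mA; rewrite -Radon_Nikodym_integral//.
    exact: gibbs_density.
rewrite /Rintegral -(Radon_Nikodym_change_of_variables bg)//; last first.
  exact: bm_integrable.
transitivity (\int[pi]_t (k t * (expR (h t) / Z))).
  congr fine; apply: ae_eq_integral => //.
  - apply: emeasurable_funM; first by apply/measurable_EFinP; case: bk.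
    by apply: (measurable_int pi); exact: Radon_Nikodym_integrable.
  - by apply/measurable_EFinP; case: (bmM bk bd).
  - by move: ae; apply: filterS => t /= /(_ I) -> _.
rewrite mulrC -RintZ; last by apply: bmM => //; exact: bm_expR.
by apply: eq_Rintegral => t _; ring.
Qed.

Lemma gibbs_Rint_expR h k : bounded_measurable h -> bounded_measurable k ->
  \int[gibbs pi h]_t expR (k t) =
  (\int[pi]_t expR (h t + k t)) / \int[pi]_t expR (h t).
Proof.
move=> bh bk; rewrite gibbs_Rint//; last exact: bm_expR.
by congr (_ / _); apply: eq_Rintegral => t _; rewrite expRD.
Qed.

End gibbs_measure.

(** If [nu] has density proportional to [expR (- g)] relative to [mu] then
    [nu(e^h) = mu(e^(h - g)) / mu(e^(- g))], and Jensen's inequality bounds the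
    denominator below by [e^(- mu(g))]. The constant [c] accounts for Gibbs
    exponents being defined only up to an additive constant. *)
Lemma gibbs_ln_expR_le d (T : measurableType d) (R : realType)
    (pi : probability T R) (h1 h2 g h : T -> R) (c : R) :
  bounded_measurable h1 -> bounded_measurable h2 -> bounded_measurable g ->
  bounded_measurable h -> (forall t, h1 t - h2 t = g t + c) ->
  ln (\int[gibbs pi h2]_t expR (h t)) <=
  ln (\int[gibbs pi h1]_t expR (h t - g t)) + \int[gibbs pi h1]_t g t.
Proof.
move=> b1 b2 bg bh h12.
have bhg := bmB bh bg.
have b2h := bmD b2 bh.
have e1 t : h1 t + (h t - g t) = c + (h2 t + h t).
  by rewrite -[h1 t](subrK (h2 t)) h12; ring.
have e2 t : h1 t + - g t = c + h2 t.
  by rewrite -[h1 t](subrK (h2 t)) h12; ring.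
have := Rint_le_ln_expR (gibbs pi h1) (bmN bg); rewrite RintN//.
rewrite !gibbs_Rint_expR//; last exact: bmN.
under [X in _ <= ln (X / _) -> _]eq_Rintegral do rewrite e2 expRD.
under [X in _ -> _ <= ln (X / _) + _]eq_Rintegral do rewrite e1 expRD.
rewrite !RintZ; [|exact: bm_expR..].
move: (Rint_expR_gt0 pi b1) (Rint_expR_gt0 pi b2) (Rint_expR_gt0 pi b2h).
move: (\int[_]_t g t) (\int[_]_t expR (h1 t)) (\int[_]_t expR (h2 t))
  (\int[_]_t expR (h2 t + h t)) => m z1 z2 z3 p1 p2 p3.
have lnE z : 0 < z -> ln (expR c * z / z1) = c + ln z - ln z1.
  move=> p; rewrite ln_div ?posrE ?mulr_gt0 ?expR_gt0//.
  by rewrite lnM ?posrE ?expR_gt0// expRK.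
rewrite !lnE// ln_div ?posrE//; clear; lra.
Qed.

(** The form in which deviation bounds are used: an exponential moment of [Z]
    under a reference Gibbs measure controls another Gibbs measure. *)
Lemma gibbs_ln_expR_dev d (T : measurableType d) (R : realType)
    (pi : probability T R) (h1 h2 g h Z : T -> R) (c C K tau : R) :
  bounded_measurable h1 -> bounded_measurable h2 -> bounded_measurable g ->
  bounded_measurable h -> bounded_measurable Z ->
  (forall t, h1 t - h2 t = g t + c) ->
  \int[gibbs pi h1]_t expR (Z t) <= expR K -> 0 <= tau <= 1 ->
  (forall t, h t - g t <= tau * Z t + C) ->
  ln (\int[gibbs pi h2]_t expR (h t)) <=
  tau * K + C + \int[gibbs pi h1]_t g t.
Proof.
move=> b1 b2 bg bh bZ h12 ZK tau01 hgZ.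
apply: (le_trans (gibbs_ln_expR_le pi b1 b2 bg bh h12)).
rewrite lerD2r -[leRHS]expRK ler_ln ?posrE ?expR_gt0 ?Rint_expR_gt0//;
  last exact: bmB.
rewrite expRD [leRHS]mulrC.
have := Rint_expR_scale_le bZ ZK tau01.
move=> /(ler_wpM2l (expR_ge0 C)); apply: le_trans.
rewrite -RintZ; last exact/bm_expR/bmZ.
apply: le_Rint.
- by apply: bm_expR; exact: bmB.
- by apply/bmZ/bm_expR; exact: bmZ.
by move=> t; rewrite -expRD ler_expR [leRHS]addrC.
Qed.

Lemma KL_refl d (T : measurableType d) (R : realType) (rho : probability T R) :
  KL rho rho = 0%E.
Proof.
rewrite /KL; have rr : rho `<< rho by move=> A.
rewrite asboolT//; set RN := Radon_Nikodym _ _.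
rewrite (ae_eq_integral (cst 0%E))//; first by rewrite integral0.
- have mRN : measurable_fun [set: T] RN.
    by apply: (measurable_int rho); exact: Radon_Nikodym_integrable.
  have mf : measurable_fun [set: T] (fun t => fine (RN t)).
    exact: measurableT_comp.
  rewrite (_ : (fun t => _) = fun t => if fine (RN t) <= 0 then -oo%E
      else (ln (fine (RN t)))%:E).
    apply: measurable_fun_ifT => //; first exact: measurable_fun_ler.
    by apply/measurable_EFinP; exact: measurableT_comp.
  apply/funext => t.
  have RNt : RN t \is a fin_num by exact: Radon_Nikodym_fin_num.
  rewrite -[in LHS](fineK RNt).
  by [].
have : ae_eq rho [set: T] RN (cst 1%E).
  apply: integral_ae_eq => //; first exact: Radon_Nikodym_integrable.
  move=> A _ mA; rewrite -Radon_Nikodym_integral//.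
  by rewrite integral_cst// mul1e.
by apply: filterS => t /= /(_ I) e _; rewrite -/(RN t) e lne1.
Qed.

(** * Exceptional events *)

(** Fubini turns a bound valid at each parameter into one for the mixture, and
    Markov's inequality makes it hold outside an event of small probability. *)
Lemma mixture_markov d1 d2 (T1 : measurableType d1) (T2 : measurableType d2)
    (R : realType) (P : probability T1 R) (mu : probability T2 R)
    (h : T1 -> T2 -> R) (K : R) :
  bounded_measurable (fun p : T1 * T2 => h p.1 p.2) ->
  (forall y, \int[P]_x expR (h x y) <= 1) ->
  measurable [set x | expR K <= \int[mu]_y expR (h x y)] /\
  (P [set x | (expR K <= \int[mu]_y expR (h x y))%R] <= (expR (- K))%:E)%E.
Proof.
move=> bh h1; have be := bm_expR bh.
have e0 x y : 0 <= expR (h x y) by exact: expR_ge0.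
have bG := @bm_Rint _ _ _ _ _ mu (fun x y => expR (h x y)) be e0.
set G := (fun x => \int[mu]_y expR (h x y)) in bG *.
have G0 x : 0 <= G x by apply: Rintegral_ge0 => *; exact: expR_ge0.
have mS : measurable [set x | expR K <= G x].
  have := measurable_fun_ler (measurable_cst (expR K)) bG.1.
  by move=> /(_ measurableT [set true]); rewrite setTI; exact.
split=> //.
have intG : (\int[P]_x (G x)%:E <= 1)%E.
  under eq_integral => x _ do
    rewrite /G -(Rint_EFin _ (bm_expR (bm_section1 x bh))).
  have -> : (\int[P]_x \int[mu]_y (expR (h x y))%:E =
      \int[mu]_y \int[P]_x (expR (h x y))%:E)%E.
    apply: (fubini_tonelli (fun p : T1 * T2 => (expR (h p.1 p.2))%:E)).
      by apply/measurable_EFinP; case: be.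
    by move=> p; rewrite lee_fin expR_ge0.
  under eq_integral => y _ do
    rewrite (Rint_EFin _ (bm_expR (bm_section2 y bh))).
  rewrite -[leRHS](_ : (\int[mu]_y (cst 1 y)%:E)%E = 1%E); last first.
    by rewrite Rint_EFin ?Rint_cst//; exact: bm_cst.
  apply: ge0_le_integral => //.
  - by move=> y _; rewrite lee_fin; apply: Rintegral_ge0 => *; exact: expR_ge0.
  - apply/measurable_EFinP.
    have bes := bm_comp be (@measurable_swap _ _ T2 T1).
    by case: (@bm_Rint _ _ _ _ _ P (fun y x => expR (h x y)) bes
      (fun y x => e0 x y)).
  - by apply/measurable_EFinP; exact: measurable_cst.
  - by move=> y _; rewrite lee_fin.
have mG : measurable_fun [set: T1] (EFin \o G).
  by apply/measurable_EFinP; case: bG.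
have := le_integral_abse P measurableT mG (expR_gt0 K).
rewrite setTI (_ : [set x | _] = [set x | expR K <= G x]); last first.
  by apply/seteqP; split => x /=; rewrite lee_fin ger0_norm.
under [leRHS]eq_integral => x _ do rewrite /= ger0_norm//.
move=> /le_trans /(_ intG); rewrite muleC -lee_pdivlMr ?expR_gt0//.
by rewrite mul1e expRN.
Qed.

Lemma union_bound d (T : measurableType d) (R : realType) (P : probability T R)
    (I : eqType) (s : seq I) (B : I -> set T) (e : R) :
  (forall i, measurable (B i) /\ (P (B i) <= e%:E)%E) ->
  exists E : set T, [/\ measurable E, ((1 - (size s)%:R * e)%:E <= P E)%E &
    forall t, E t -> forall i, i \in s -> ~ B i t].
Proof.
move=> Be; pose U := \big[setU/set0]_(i <- s) B i.
have mU : measurable U by apply: bigsetU_measurable => i _; exact: (Be i).1.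
exists (~` U); split.
- exact: measurableC.
- rewrite probability_setC// EFinB leeB//.
  rewrite /U {mU U}; elim: s => [|i s IHs].
    by rewrite big_nil measure0 mul0r.
  rewrite big_cons /= -natr1 mulrDl mul1r addrC EFinD.
  have [mi Pi] := Be i.
  apply: le_trans (measureU2 _ mi _) _; last exact: leeD.
  by apply: bigsetU_measurable => j _; exact: (Be j).1.
move=> t Ut i; rewrite /U in Ut => iS Bt; apply: Ut.
by rewrite (big_rem i)//=; left.
Qed.

(** * Elementary bounds on exponential functions *)

(** Squaring the tangent bound at [u / 2] gives [expR u <= (1 - u / 2) ^- 2];
    the polynomial bound then holds as long as [1 - 3 * u + u ^+ 2 >= 0]. *)
Lemma expR_le_quadratic (R : realType) (u : R) : 4 * u <= 1 ->
  expR u <= 1 + u + u ^+ 2.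
Proof.
move=> u14; have h0 : 0 < 1 - u / 2 by lra.
have : (1 - u / 2) ^+ 2 * expR u <= 1.
  have e0 := expR_gt0 (- (u / 2)).
  have h2 : (1 - u / 2) ^+ 2 <= expR (- (u / 2)) ^+ 2.
    have h3 := expR_ge1Dx (- (u / 2)).
    by rewrite ler_pXn2r ?nnegrE//; lra.
  have e1 : 1 = expR (- (u / 2)) ^+ 2 * expR u.
    by rewrite -expRM_natl -expRD -expR0; congr expR; field.
  by rewrite [leRHS]e1 ler_wpM2r ?expR_ge0.
set p := expR u => hp.
have p0 : 0 < p by exact: expR_gt0.
have h2 : 1 <= (1 - u / 2) ^+ 2 * (1 + u + u ^+ 2).
  rewrite -subr_ge0.
  rewrite (_ : _ - 1 = u ^+ 2 / 4 * ((1 - 4 * u) + u + u ^+ 2)); last by field.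
  have : 0 <= (1 - 4 * u) + u + u ^+ 2.
    by have := sqr_ge0 (u - 1 / 4); lra.
  by move=> h; rewrite mulr_ge0// divr_ge0 ?sqr_ge0.
rewrite -(@ler_pM2l _ ((1 - u / 2) ^+ 2)) ?exprn_gt0//.
exact: le_trans hp h2.
Qed.

Section hyperbolic_bounds.
Context (R : realType).
Implicit Types x y : R.

Lemma cosh_ge1 x : 1 <= cosh x.
Proof.
by rewrite /cosh; have := expR_ge1Dx x; have := expR_ge1Dx (- x); lra.
Qed.

Lemma ln_cosh_le x : 0 <= x -> 4 * x <= 1 -> 0 <= ln (cosh x) <= x ^+ 2.
Proof.
move=> x0 x1; apply/andP; split; first by rewrite ln_ge0 ?cosh_ge1.
have c1 := cosh_ge1 x.
have := @le_ln1Dx R (cosh x - 1).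
rewrite (_ : 1 + (cosh x - 1) = cosh x); last by ring.
move=> lnc; apply: le_trans (lnc _) _; first by lra.
have := expR_le_quadratic x1.
have := @expR_le_quadratic R (- x); rewrite sqrrN /cosh => /(_ _).
lra.
Qed.

Lemma tanh_ge x : 0 <= x -> 4 * x <= 1 -> 3 / 4 * x <= tanh x.
Proof.
move=> x0 x1; have e0 := expR_gt0 x; have e1 := expR_gt0 (- x).
rewrite /tanh ler_pdivlMr ?addr_gt0//.
have := expR_ge1Dx x.
have := expR_le_quadratic x1.
have := @expR_le_quadratic R (- x); rewrite sqrrN => /(_ _).
move: e0 e1; set p := expR x; set q := expR (- x) => p0 q0 h1 h2 h3.
have {}h1 : q <= 1 + - x + x ^+ 2 by apply: h1; lra.
have : 3 / 4 * x * (p + q) <= 3 / 4 * x * (2 + 2 * x ^+ 2).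
  by apply: ler_wpM2l; lra.
have : x ^+ 2 <= 1 / 4 * x by nra.
have : x * x ^+ 2 <= 1 / 16 * x by nra.
lra.
Qed.

(** Since [ln (1 - v) <= - v], the function inverted here lies above the line of
    slope [N * tanh (gamma / N) - b], which is at least [gamma / 4]. *)
Lemma Fga_inv_le (N : nat) (gamma b y z : R) : (0 < N)%N -> 0 < gamma ->
  4 * gamma <= N%:R -> b <= gamma / 2 -> y <= z -> 0 <= z ->
  Fga_inv N gamma b y <= 4 * z / gamma.
Proof.
move=> N0 g0 g4 bg yz z0; rewrite /Fga_inv.
(* If the equation has no solution, the inverse takes the default value 0. *)
case: xgetP => [u _ [/andP[u0 ut] Fu]|_]; last first.
  by rewrite divr_ge0 ?mulr_ge0// ltW.
have N0R : 0 < N%:R :> R by rewrite ltr0n.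
have x0 : 0 < gamma / N%:R by rewrite divr_gt0.
have x4 : 4 * (gamma / N%:R) <= 1 by rewrite mulrA ler_pdivrMr// mul1r.
have := tanh_ge (ltW x0) x4; move: ut Fu; rewrite /Fga.
set t := tanh _ => ut Fu th.
have t0 : 0 < t by apply: lt_le_trans th; rewrite mulr_gt0.
have tu : t * u < 1 by rewrite mulrC -ltr_pdivlMr// mul1r.
have lnb : ln (1 - t * u) <= - (t * u) by apply: le_ln1Dx; lra.
have Nt : 3 / 4 * gamma <= N%:R * t.
  have -> : 3 / 4 * gamma = N%:R * (3 / 4 * (gamma / N%:R)).
    by field; rewrite gt_eqF.
  by rewrite ler_wpM2l// ltW.
rewrite ler_pdivlMr//.
have := ler_wpM2l (ltW N0R) lnb.
have := ler_wpM2r u0 Nt; have := ler_wpM2r u0 bg.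
lra.
Qed.

End hyperbolic_bounds.

(** * Products of simple functions under a product measure *)

Section product_expectation.
Context d (T : measurableType d) (R : realType) (N : nat).
Context (P_ : 'I_N -> probability T R) (P : probability (N.-tuple T) R)
  (P_prod : is_product_measure P_ P).

Lemma rectangle_measurable (A : 'I_N -> set T) : (forall i, measurable (A i)) ->
  measurable [set w : N.-tuple T | forall i, A i (tnth w i)].
Proof.
move=> mA; rewrite (_ : mkset _ =
    \bigcap_(i in [set: 'I_N]) ((fun w : N.-tuple T => tnth w i) @^-1` A i)).
  apply: fin_bigcap_measurable => // i _.
  by rewrite -[X in measurable X]setTI; exact: measurable_tnth.
by apply/seteqP; split => w /= Aw i; [move=> _; exact: Aw|exact: Aw].
Qed.

Lemma rectangle_prob (A : 'I_N -> set T) : (forall i, measurable (A i)) ->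
  fine (P [set w : N.-tuple T | forall i, A i (tnth w i)]) =
  \prod_(i < N) fine (P_ i (A i)).
Proof.
move=> mA; rewrite P_prod//.
rewrite (eq_bigr (fun i => (fine (P_ i (A i)))%:E)) ?prodEFin//.
by move=> i _; rewrite fineK// fin_num_measure.
Qed.

Lemma marginal_prob (i : 'I_N) (B : set T) : measurable B ->
  fine (P [set w : N.-tuple T | B (tnth w i)]) = fine (P_ i B).
Proof.
move=> mB; pose A j := if j == i then B else setT.
have -> : [set w : N.-tuple T | B (tnth w i)] =
    [set w | forall j, A j (tnth w j)].
  apply/seteqP; split => w /=; last by move=> /(_ i); rewrite /A eqxx.
  by move=> Bw j; rewrite /A; case: eqP => // ->.
rewrite rectangle_prob; last by move=> j; rewrite /A; case: ifP.
rewrite (bigD1 i)//= big1 ?mulr1; first by rewrite /A eqxx.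
by move=> j /negPf ji; rewrite /A ji probability_setT.
Qed.

(** Expanding the product turns the integrand into a combination of indicators
    of rectangles, on which the product rule applies term by term. *)
Lemma product_simple_Rint (k : nat) (c : 'I_N -> 'I_k -> R)
    (A : 'I_N -> 'I_k -> set T) : (forall i j, measurable (A i j)) ->
  \int[P]_w \prod_(i < N) \sum_(j < k) c i j * \1_(A i j) (tnth w i) =
  \prod_(i < N) \sum_(j < k) c i j * fine (P_ i (A i j)).
Proof.
move=> mA.
pose rect (s : {ffun 'I_N -> 'I_k}) :=
  [set w : N.-tuple T | forall i, A i (s i) (tnth w i)].
have mr s : measurable (rect s).
  exact: (@rectangle_measurable (fun i => A i (s i))).
have bm1 (B : set (N.-tuple T)) : measurable B ->
    bounded_measurable (\1_B : N.-tuple T -> R).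
  move=> mB; split; first exact: measurable_indic.
  by exists 1 => w; rewrite indicE ger0_norm// lern1 leq_b1.
transitivity (\int[P]_w \sum_(s : {ffun 'I_N -> 'I_k})
    (\prod_(i < N) c i (s i)) * \1_(rect s) w).
  apply: eq_Rintegral => w _; rewrite bigA_distr_bigA/=.
  apply: eq_bigr => s _; rewrite big_split/=; congr (_ * _).
  rewrite indicE; case: (boolP (w \in rect s)) => /= ws.
    rewrite big1// => i _; rewrite indicE mem_set//.
    by move: ws; rewrite inE; exact.
  have [i Ni] : exists i, ~ A i (s i) (tnth w i).
    by apply/existsNP => h; move: ws; rewrite mem_set.
  by rewrite (bigD1 i)//= indicE memNset// mul0r.
rewrite bigA_distr_bigA/=.
suff {1}-> (r : seq {ffun 'I_N -> 'I_k}) : \int[P]_w \sum_(s <- r)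
    (\prod_(i < N) c i (s i)) * \1_(rect s) w =
    \sum_(s <- r) \prod_(i < N) (c i (s i) * fine (P_ i (A i (s i)))) by [].
have bmr (l : seq {ffun 'I_N -> 'I_k}) : bounded_measurable
    (fun w => \sum_(s <- l) (\prod_(i < N) c i (s i)) * \1_(rect s) w).
  elim: l => [|s l IHl].
    by under eq_fun do rewrite big_nil; exact: bm_cst.
  under eq_fun do rewrite big_cons.
  by apply: bmD => //; apply: bmZ; exact: bm1.
elim: r => [|s r IHr].
  by under eq_Rintegral do rewrite big_nil; rewrite Rint_cst big_nil.
under eq_Rintegral do rewrite big_cons.
rewrite RintD//; last by apply: bmZ; exact: bm1.
rewrite big_cons IHr; congr (_ + _).
rewrite RintZ; last exact: bm1.
rewrite big_split/= /Rintegral integral_indic// setIT.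
by rewrite (rectangle_prob (fun i => mA i (s i))).
Qed.

End product_expectation.

(** * Zero-one losses and their deviations *)

(** The last term compensates the mean of the distance term and the
    second-order part of the first term, so that the exponential has mean at
    most one over the sample; see [deviation_expR_le1]. *)
Definition deviation (R : realType) (T : Type) (r Rk m M : T -> R) (a s : R)
    (t : T) : R :=
  s * (r t - Rk t) + a * m t - 3 * a * M t.

Section sample.
Context dX (X : measurableType dX) dY (Y : measurableType dY)
  dT (Theta : measurableType dT) (R : realType) (N : nat).
Context (f : Theta -> X -> Y).
Context (Y_fin : finite_set [set: Y])
  (Y_discrete : forall S : set Y, measurable S)
  (f_meas : measurable_fun [set: Theta * X] (fun p => f p.1 p.2)).

Notation sample := (N.-tuple (X * Y)).
Notation err := (err R f).

(** The complement is a finite union, over the labels, of intersections of two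
    measurable preimages. *)
Lemma error_set_measurable :
  measurable [set p : Theta * (X * Y) | f p.1 p.2.1 <> p.2.2].
Proof.
have mf : measurable_fun [set: Theta * (X * Y)] (fun p => f p.1 p.2.1).
  apply: (measurableT_comp f_meas (g := fun p => (p.1, p.2.1))).
  by apply: measurable_fun_pair => //; exact: measurableT_comp.
have mS : measurable_fun [set: Theta * (X * Y)] (fun p => p.2.2).
  exact: measurableT_comp.
rewrite -[X in measurable X]setCK; apply: measurableC.
rewrite (_ : ~` _ = \bigcup_(y in [set: Y])
   ((fun p : Theta * (X * Y) => f p.1 p.2.1) @^-1` [set y] `&`
    (fun p => p.2.2) @^-1` [set y])).
  apply: fin_bigcup_measurable => // y _; apply: measurableI.
    by rewrite -[X in measurable X]setTI; exact: mf.
  by rewrite -[X in measurable X]setTI; exact: mS.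
apply/seteqP; split => p /=.
  by move=> /contrapT e; exists p.2.2.
by move=> [y _ [/= -> ->]].
Qed.

Lemma bm_err d (S : measurableType d) (th : S -> Theta) (z : S -> X * Y) :
  measurable_fun [set: S] th -> measurable_fun [set: S] z ->
  bounded_measurable (fun s => err (th s) (z s)).
Proof.
move=> mth mz; split; last first.
  by exists 1 => s; rewrite /Defs.err indicE ger0_norm// lern1 leq_b1.
rewrite (_ : (fun s => _) = \1_[set p : Theta * (X * Y) | f p.1 p.2.1 <> p.2.2]
    \o (fun s => (th s, z s))); last by apply/funext => s.
apply: measurableT_comp.
  by apply: measurable_indic; exact: error_set_measurable.
exact: measurable_fun_pair.
Qed.

Lemma err_set_measurable th : measurable [set z : X * Y | f th z.1 <> z.2].
Proof.
have := pair1_measurable th measurableT error_set_measurable.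
by rewrite setTI.
Qed.

Lemma bm_emp_risk d (S : measurableType d) (w : S -> sample) (th : S -> Theta) :
  measurable_fun [set: S] w -> measurable_fun [set: S] th ->
  bounded_measurable (fun s => emp_risk R f (w s) (th s)).
Proof.
move=> mw mth; apply: bmZ; apply: bm_sum => i; apply: bm_err => //.
exact: measurableT_comp (measurable_tnth i) mw.
Qed.

Lemma bm_emp_dist d (S : measurableType d) (w : S -> sample)
    (th th' : S -> Theta) : measurable_fun [set: S] w ->
  measurable_fun [set: S] th -> measurable_fun [set: S] th' ->
  bounded_measurable (fun s => emp_dist R f (w s) (th s) (th' s)).
Proof.
move=> mw mth mth'; apply: bmZ; apply: bm_sum => i; apply: bm_normr.
apply: bmB; apply: bm_err => //;
  exact: measurableT_comp (measurable_tnth i) mw.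
Qed.

Lemma emp_risk_ge0 w th : 0 <= emp_risk R f (N := N) w th.
Proof. by rewrite mulr_ge0// sumr_ge0// => i _; rewrite /Defs.err indicE. Qed.

Lemma emp_dist_ge0 w th th' : 0 <= emp_dist R f (N := N) w th th'.
Proof. by rewrite mulr_ge0// sumr_ge0. Qed.

Lemma emp_dist_triangle w th th' th0 : emp_dist R f (N := N) w th th' <=
  emp_dist R f w th th0 + emp_dist R f w th' th0.
Proof.
rewrite /emp_dist -mulrDr -big_split/= ler_wpM2l// ler_sum// => i _.
by rewrite [in leRHS](distrC (err th' _)) ler_distD.
Qed.

Section population.
Context (P_ : 'I_N -> probability (X * Y)%type R) (P : probability sample R)
  (P_prod : is_product_measure P_ P).

Lemma Rint_coordinate (B : set (X * Y)) i : measurable B ->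
  \int[P]_w \1_B (tnth w i) = fine (P_ i B).
Proof.
move=> mB; rewrite -(marginal_prob P_prod i mB) /Rintegral.
rewrite -[in RHS](setIT [set w | _]) -integral_indic//; last first.
  by have := measurable_tnth i measurableT mB; rewrite setTI.
Qed.

Lemma Rint_sum (mu : probability sample R) (h : 'I_N -> sample -> R) :
  (forall i, bounded_measurable (h i)) ->
  \int[mu]_w \sum_(i < N) h i w = \sum_(i < N) \int[mu]_w h i w.
Proof.
move=> bh; elim: (index_enum _) => [|i s IHs].
  by under eq_Rintegral do rewrite big_nil; rewrite Rint_cst big_nil.
under eq_Rintegral do rewrite big_cons.
by rewrite RintD ?IHs ?big_cons//; exact: bm_sum.
Qed.

Lemma risk_mean th : risk f P th = \int[P]_w emp_risk R f w th.
Proof.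
have bm_e i : bounded_measurable (fun w : sample => err th (tnth w i)).
  by apply: bm_err => //; exact: measurable_tnth.
rewrite RintZ; last exact: bm_sum.
rewrite Rint_sum//.
congr (_ * _); apply: eq_bigr => i _.
rewrite Rint_coordinate; last exact: err_set_measurable.
by rewrite -(marginal_prob P_prod)//; exact: err_set_measurable.
Qed.

Lemma bm_risk : bounded_measurable (risk f P).
Proof.
rewrite (_ : risk f P = fun th => \int[P]_w emp_risk R f w th); last first.
  by apply/funext => th; exact: risk_mean.
apply: (@bm_Rint _ _ _ _ _ P (fun th w => emp_risk R f w th)).
  exact: bm_emp_risk.
by move=> *; exact: emp_risk_ge0.
Qed.

Lemma bm_exp_dist th0 : bounded_measurable (exp_dist f P ^~ th0).
Proof.
apply: (@bm_Rint _ _ _ _ _ P (fun th w => emp_dist R f w th th0)).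
  by apply: bm_emp_dist.
by move=> *; exact: emp_dist_ge0.
Qed.

Section moment.
Context (th0 th : Theta).

(** The possible values of a difference of two zero-one losses. *)
Let v (j : 'I_3) : R := nth 0 [:: 0; 1; -1] j.
Let gap (z : X * Y) : R := err th z - err th0 z.
Let A (j : 'I_3) : set (X * Y) := [set z | gap z = v j].

Let vcase j : [\/ v j = 0, v j = 1 | v j = -1].
Proof.
case: j => -[|[|[|//]]] hj; rewrite /v /=;
  by [constructor 1|constructor 2|constructor 3].
Qed.

Let mA j : measurable (A j).
Proof.
have bg : bounded_measurable gap by apply: bmB; exact: bm_err.
have := bg.1 measurableT [set v j] (measurable_set1 _).
by rewrite setTI.
Qed.

Let gap_expand (g : R -> R) z : g (gap z) = \sum_(j < 3) g (v j) * \1_(A j) z.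
Proof.
rewrite !big_ord_recl big_ord0 addr0 !indicE /A /v /=.
have E k : (z \in [set z | gap z = k]) = (gap z == k).
  by apply/idP/eqP; rewrite inE.
rewrite !E /gap /Defs.err !indicE.
by case: (_ \in _); case: (_ \in _);
  rewrite ?subrr ?subr0 ?sub0r ?eqxx ?oner_eq0 ?oppr_eq0 ?oner_eq0
  ?[0 == 1]eq_sym ?[0 == -1]eq_sym ?oppr_eq0 ?oner_eq0
  ?(gt_eqF (_ : -1 < 1 :> R)) ?(lt_eqF (_ : -1 < 1 :> R)) ?gtrN
  ?mulr1 ?mulr0 ?addr0 ?add0r.
Qed.

Let Rint_gap (g : R -> R) i :
  \int[P]_w g (gap (tnth w i)) = \sum_(j < 3) g (v j) * fine (P_ i (A j)).
Proof.
under eq_Rintegral do rewrite gap_expand.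
rewrite !big_ord_recl big_ord0.
under eq_Rintegral do rewrite !big_ord_recl big_ord0.
have b1 j : bounded_measurable (fun w : sample => \1_(A j) (tnth w i) : R).
  split; last by exists 1 => w; rewrite indicE ger0_norm// lern1 leq_b1.
  exact: measurableT_comp (measurable_tnth i).
rewrite !RintD; do ?[by apply: bmZ|by apply: bmD; apply: bmZ|exact: bm_cst
  |by apply: bmD; [exact: bmZ|exact: bm_cst]
  |by apply: bmD; [exact: bmZ|apply: bmD; [exact: bmZ|exact: bm_cst]]].
by rewrite Rint_cst !RintZ// !Rint_coordinate.
Qed.

Let bm_gap i : bounded_measurable (fun w : sample => gap (tnth w i)).
Proof. by apply: bmB; apply: bm_err => //; exact: measurable_tnth. Qed.

Let p i j := fine (P_ i (A j)).

Let sum_p i : \sum_(j < 3) p i j = 1.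
Proof.
have := Rint_gap (fun=> 1) i; rewrite Rint_cst => ->.
by apply: eq_bigr => j _; rewrite mul1r.
Qed.

Let excess_riskE : risk f P th - risk f P th0 =
  N%:R^-1 * \sum_(i < N) \sum_(j < 3) v j * p i j.
Proof.
rewrite !risk_mean -RintB; [|exact: bm_emp_risk|exact: bm_emp_risk].
under eq_Rintegral => w _ do rewrite /emp_risk -mulrBr -sumrB.
rewrite RintZ; last by apply: bm_sum => i; exact: bm_gap.
rewrite Rint_sum//; congr (_ * _); apply: eq_bigr => i _.
exact: (Rint_gap id).
Qed.

Let exp_distE : exp_dist f P th th0 =
  N%:R^-1 * \sum_(i < N) \sum_(j < 3) `|v j| * p i j.
Proof.
rewrite /exp_dist RintZ; last by apply: bm_sum => i; exact/bm_normr/bm_gap.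
rewrite Rint_sum; last by move=> i; exact/bm_normr/bm_gap.
congr (_ * _); apply: eq_bigr => i _.
exact: (Rint_gap (fun x => `|x|)).
Qed.

(** Each observation contributes [u = (s * v + a * |v|) / N] with [v] in
    [{0, 1, -1}], so [u ^+ 2] is at most [2 * a / N] times [|v|] and the
    quadratic bound on the exponential only inflates the coefficient of the
    distance from [a] to [3 * a]. Independence multiplies these bounds. *)
Lemma deviation_expR_le1 (a s : R) : (0 < N)%N -> 0 <= a ->
  4 * (`|s| + a) <= N%:R -> (`|s| + a) ^+ 2 <= 2 * a * N%:R ->
  \int[P]_w expR (deviation (fun t => emp_risk R f w t - emp_risk R f w th0)
      (fun t => risk f P t - risk f P th0)
      (fun t => emp_dist R f w t th0) (exp_dist f P ^~ th0) a s th) <= 1.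
Proof.
move=> N0 a0 sa1 sa2.
have N0R : 0 < N%:R :> R by rewrite ltr0n.
have q0 : 0 <= `|s| + a by rewrite addr_ge0.
pose u j := (s * v j + a * `|v j|) / N%:R.
have vb j : `|v j| ^+ 2 = `|v j| /\ `|v j| <= 1.
  by case: (vcase j) => ->; rewrite ?normr0 ?normrN ?normr1 ?expr1n ?expr0n.
have ub j : `|u j| <= (`|s| + a) / N%:R * `|v j|.
  rewrite /u normrM normfV (gtr0_norm N0R) [leRHS]mulrAC.
  rewrite ler_wpM2r ?invr_ge0 ?(ltW N0R)//.
  rewrite (le_trans (ler_normD _ _))// !normrM normr_id (ger0_norm a0).
  by rewrite mulrDl.
have term i : \sum_(j < 3) expR (u j) * p i j <=
    expR (\sum_(j < 3) (s * v j + 3 * a * `|v j|) / N%:R * p i j).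
  apply: le_trans (expR_ge1Dx _).
  rewrite -[X in X + _](sum_p i) -big_split/= ler_sum// => j _.
  rewrite -[X in X + _]mul1r -mulrDl ler_wpM2r//; first exact: fine_ge0.
  have [v2 v1] := vb j; have uj := ub j.
  have u4 : 4 * u j <= 1.
    have : `|u j| <= (`|s| + a) / N%:R.
      by apply: (le_trans uj); rewrite ler_piMr// divr_ge0 ?(ltW N0R).
    rewrite ler_pdivlMr// => h; have := ler_norm (u j).
    have : 4 * `|u j| * N%:R <= 1 * N%:R by lra.
    by rewrite ler_pM2r// => ? ?; lra.
  apply: (le_trans (expR_le_quadratic u4)).
  have u2 : u j ^+ 2 <= 2 * a / N%:R * `|v j|.
    rewrite -real_normK ?num_real//.
    have : `|u j| ^+ 2 <= ((`|s| + a) / N%:R * `|v j|) ^+ 2.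
      by rewrite ler_pXn2r ?nnegrE// (le_trans _ uj).
    move=> /le_trans; apply; rewrite exprMn v2 ler_wpM2r//.
    rewrite expr_div_n ler_pdivrMr ?exprn_gt0//.
    by rewrite (_ : _ * _ ^+ 2 = 2 * a * N%:R)//; field; rewrite gt_eqF.
  rewrite -addrA lerD2l.
  apply: (le_trans (lerD (lexx (u j)) u2)); rewrite /u.
  by rewrite le_eqVlt; apply/orP; left; apply/eqP; field; rewrite gt_eqF.
have step w : expR (deviation (fun t => emp_risk R f w t - emp_risk R f w th0)
      (fun t => risk f P t - risk f P th0)
      (fun t => emp_dist R f w t th0) (exp_dist f P ^~ th0) a s th) =
    expR (- (s * (risk f P th - risk f P th0) + 3 * a * exp_dist f P th th0)) *
    \prod_(i < N) \sum_(j < 3) expR (u j) * \1_(A j) (tnth w i).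
  have -> : \prod_(i < N) \sum_(j < 3) expR (u j) * \1_(A j) (tnth w i) =
      \prod_(i < N) expR ((s * gap (tnth w i) + a * `|gap (tnth w i)|) / N%:R).
    apply: eq_bigr => i _.
    by rewrite (gap_expand (fun x => expR ((s * x + a * `|x|) / N%:R))).
  rewrite -expR_sum -expRD; congr expR; rewrite /deviation /emp_dist.
  rewrite /emp_risk -mulrBr -sumrB -mulr_suml.
  rewrite [X in _ + X / _]big_split/= -!mulr_sumr.
  by rewrite /gap; ring.
have bt i : bounded_measurable (fun w : sample =>
    \sum_(j < 3) expR (u j) * \1_(A j) (tnth w i)).
  apply: bm_sum => j; apply: bmZ; split.
    exact: measurableT_comp (measurable_tnth i).
  by exists 1 => w; rewrite indicE ger0_norm// lern1 leq_b1.
under eq_Rintegral => w _ do rewrite step.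
rewrite RintZ; last first.
  elim: (index_enum _) => [|i l IHl].
    by under eq_fun do rewrite big_nil; exact: bm_cst.
  by under eq_fun do rewrite big_cons; exact: bmM.
rewrite (product_simple_Rint P_prod (fun _ j => expR (u j))); last first.
  by move=> _; exact: mA.
rewrite expRN mulrC ler_pdivrMr ?expR_gt0// mul1r.
apply: (@le_trans _ _ (\prod_(i < N)
    expR (\sum_(j < 3) (s * v j + 3 * a * `|v j|) / N%:R * p i j))).
  apply: ler_prod => i _; rewrite term andbT sumr_ge0// => j _.
  by rewrite mulr_ge0 ?expR_ge0// fine_ge0.
rewrite -expR_sum ler_expR excess_riskE exp_distE.
rewrite le_eqVlt; apply/orP; left; apply/eqP.
rewrite !mulr_sumr -big_split/=; apply: eq_bigr => i _.
rewrite !mulr_sumr -big_split/=; apply: eq_bigr => j _.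
by ring.
Qed.

End moment.
End population.
End sample.

Section events.
Context dX (X : measurableType dX) dY (Y : measurableType dY)
  dT (Theta : measurableType dT) (R : realType) (N : nat) (N_gt0 : (0 < N)%N).
Context (f : Theta -> X -> Y).
Context (Y_fin : finite_set [set: Y])
  (Y_discrete : forall S : set Y, measurable S)
  (f_meas : measurable_fun [set: Theta * X] (fun p => f p.1 p.2)).
Context (P_ : 'I_N -> probability (X * Y)%type R)
  (P : probability (N.-tuple (X * Y)) R) (P_prod : is_product_measure P_ P).
Context (pi : probability Theta R) (th0 : Theta).

Local Notation dev gamma s w := (deviation
  (fun th => emp_risk R f w th - emp_risk R f w th0)
  (fun th => risk f P th - risk f P th0)
  (emp_dist R f w ^~ th0) (exp_dist f P ^~ th0) (gamma ^+ 2 / N%:R) s).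
Local Notation prior b := (gibbs pi (fun th => - (b * risk f P th))).

(** The condition [4 * gamma <= N] keeps each observation in the range where
    the quadratic bound on the exponential is valid. *)
Lemma deviation_event (gamma b s K : R) : 0 < gamma -> 4 * gamma <= N%:R ->
  2 * `|s| <= gamma ->
  let B := [set w | expR K <= \int[prior b]_th expR (dev gamma s w th)] in
  measurable B /\ (P B <= (expR (- K))%:E)%E.
Proof.
move=> g0 g4 sg; have N0R : 0 < N%:R :> R by rewrite ltr0n.
set a := gamma ^+ 2 / N%:R.
have a4 : 4 * a <= gamma.
  rewrite /a mulrA ler_pdivrMr// expr2 mulrA [leRHS]mulrC ler_wpM2r//.
  exact: ltW.
have a0 : 0 <= a by rewrite divr_ge0 ?sqr_ge0.
have s0 := normr_ge0 s.
apply: (@mixture_markov _ _ _ _ _ P (prior b) (fun w => dev gamma s w)).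
  apply: bmB; first apply: bmD; apply: bmZ.
  - apply: bmB; apply: bmB.
    + by apply: bm_emp_risk.
    + by apply: bm_emp_risk.
    + exact: bm_comp (bm_risk Y_fin Y_discrete f_meas P_prod) measurable_snd.
    + exact: bm_cst.
  - by apply: bm_emp_dist.
  - exact: bm_comp (bm_exp_dist Y_fin Y_discrete f_meas P th0) measurable_snd.
move=> th; apply: (deviation_expR_le1 Y_fin Y_discrete f_meas P_prod) => //.
  by rewrite -/a; lra.
rewrite -/a (_ : 2 * a * N%:R = 2 * gamma ^+ 2); last first.
  by rewrite /a; field; rewrite gt_eqF.
apply: (@le_trans _ _ (gamma ^+ 2)); last by have := sqr_ge0 gamma; lra.
by rewrite ler_pXn2r ?nnegrE //; lra.
Qed.

(** The six deviation bounds listed here serve, in pairs of opposite signs, to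
    compare the posterior at [gamma / 2] with the prior at [gamma / 8], and that
    at [2 * beta] with the priors at [beta] and [4 * beta]. *)
Lemma good_event (G : seq R) (K : R) :
  exists E : set (N.-tuple (X * Y)),
    [/\ measurable E,
        ((1 - (6 * size G ^ 2)%:R * expR (- K))%:E <= P E)%E &
    forall w, E w -> forall beta gamma, beta \in G -> gamma \in G ->
    0 < beta -> 16 * beta <= gamma -> 4 * gamma <= N%:R ->
    forall b s, (b, s) \in
      [:: (gamma / 8, gamma / 2); (gamma / 8, - (gamma / 2));
      (beta, 2 * beta); (beta, - (2 * beta));
      (4 * beta, gamma / 2); (4 * beta, - (gamma / 2))] ->
    \int[prior b]_th expR (dev gamma s w th) <= expR K].
Proof.
pose levels (p : R * R) := [:: (p.2 / 8, p.2 / 2); (p.2 / 8, - (p.2 / 2));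
  (p.1, 2 * p.1); (p.1, - (2 * p.1));
  (4 * p.1, p.2 / 2); (4 * p.1, - (p.2 / 2))].
pose level q := nth (0, 0) (levels q.1) q.2.
(* Pairs outside the regime get the empty event, which keeps the union bound
   uniform over all pairs. *)
pose B (q : R * R * nat) : set (N.-tuple (X * Y)) :=
  if [&& 0 < q.1.1, 16 * q.1.1 <= q.1.2,
    4 * q.1.2 <= N%:R & (q.2 < 6)%N]
  then [set w | expR K <=
    \int[prior (level q).1]_th expR (dev q.1.2 (level q).2 w th)]
  else set0.
pose idx := [seq (p, k) | p <- [seq (b, g) | b <- G, g <- G], k <- iota 0 6].
have BP q : measurable (B q) /\ (P (B q) <= (expR (- K))%:E)%E.
  rewrite /B; case: ifPn => [|_]; last first.
    by split => //; rewrite measure0 lee_fin expR_ge0.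
  case: q => -[b g] k /= /and4P[b0 bg g4 k6].
  have g0 : 0 < g by lra.
  apply: deviation_event => //.
  rewrite /level /=; move: k k6 => [|[|[|[|[|[|//]]]]]] _ /=;
    rewrite ?normrN gtr0_norm ?divr_gt0 ?mulr_gt0//; lra.
have [E [mE PE E_good]] := union_bound idx BP.
exists E; split => //.
  by move: PE; rewrite !size_allpairs size_iota [(_ * 6)%N]mulnC.
move=> w Ew beta gamma bG gG b0 bg g4 b s /(nthP (0, 0))[k k6 lk].
have qI : ((beta, gamma), k) \in idx.
  by rewrite allpairs_f ?allpairs_f// mem_iota.
have := E_good w Ew _ qI; rewrite /B /= b0 bg g4.
rewrite (_ : (k < 6)%N = true)//= /level /= lk /=.
by move=> /negP; rewrite -ltNge => /ltW.
Qed.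

End events.

(** * Comparison of empirical and population Gibbs measures *)

Section localized_comparison.
Context dT (T : measurableType dT) (R : realType) (pi : probability T R).
Context (r Rk m M e E : T -> R) (ce cE : R).
Context (eE : forall t, e t = r t + ce) (EE : forall t, E t = Rk t + cE).
Context (br : bounded_measurable r) (bR : bounded_measurable Rk)
  (bm : bounded_measurable m) (bM : bounded_measurable M).
Context (Rk_ge0 : forall t, 0 <= Rk t) (m_ge0 : forall t, 0 <= m t).
Context (beta gamma a K Phi D : R).
Context (beta_gt0 : 0 < beta) (gamma_ge : 16 * beta <= gamma) (a_ge0 : 0 <= a)
  (K_ge0 : 0 <= K) (Phi_ge0 : 0 <= Phi).
Context (margin_le : forall t, 3 * a * M t <= 3 / 2 * Phi + beta / 8 * Rk t).

Local Notation prior b := (gibbs pi (fun t => - (b * E t))).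
Local Notation posterior b := (gibbs pi (fun t => - (b * e t))).
Local Notation Z := (deviation r Rk m M a).
Local Notation concentrated b s := (\int[prior b]_t expR (Z s t) <= expR K).

Let bZ s : bounded_measurable (Z s).
Proof.
by apply: bmB; [apply: bmD; apply: bmZ => //; exact: bmB|exact: bmZ].
Qed.

Let be : bounded_measurable e.
Proof.
rewrite (_ : e = fun t => r t + ce); last exact/funext.
by apply: bmD => //; exact: bm_cst.
Qed.

Let bE : bounded_measurable E.
Proof.
rewrite (_ : E = fun t => Rk t + cE); last exact/funext.
by apply: bmD => //; exact: bm_cst.
Qed.

Let Rint_ge0 (mu : probability T R) : 0 <= \int[mu]_t Rk t.
Proof. exact: Rintegral_ge0. Qed.

(** Jensen's inequality turns the exponential bound under the reference measure
    into a bound on its mean risks. *)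
Lemma concentrated_mean_le b s : concentrated b s ->
  s * (\int[prior b]_t r t - \int[prior b]_t Rk t) <=
  K + 3 / 2 * Phi + beta / 8 * \int[prior b]_t Rk t.
Proof.
move=> dev; set mu := prior b.
have bL : bounded_measurable
    (fun t => s * (r t - Rk t) - (3 / 2 * Phi + beta / 8 * Rk t)).
  apply: bmB; first by apply: bmZ; exact: bmB.
  by apply: bmD; [exact: bm_cst|exact: bmZ].
have : \int[mu]_t (s * (r t - Rk t) - (3 / 2 * Phi + beta / 8 * Rk t)) <=
    \int[mu]_t Z s t.
  apply: le_Rint => // t; rewrite /deviation.
  by have := margin_le t; have := mulr_ge0 a_ge0 (m_ge0 t); lra.
move=> /le_trans /(_ (Rint_le_ln_expR mu (bZ s))).
rewrite RintB; [|by apply: bmZ; exact: bmB|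
  by apply: bmD; [exact: bm_cst|exact: bmZ]].
rewrite RintZ; last exact: bmB.
rewrite RintB// RintD; [|exact: bm_cst|exact: bmZ].
rewrite Rint_cst RintZ//.
have : ln (\int[mu]_t expR (Z s t)) <= K.
  by rewrite -[leRHS]expRK ler_ln ?posrE ?expR_gt0 ?Rint_expR_gt0.
lra.
Qed.

(** A reference measure less concentrated than the posterior controls it from
    above. Since [b] is not much smaller than [l], the mean of
    [l * r - b * Rk] under the reference is at most [4 * D] up to the terms in
    [K] and [Phi], whatever the temperature. *)
Lemma posterior_ln_expR_le (l b tau : R) (h : T -> R) :
  0 < b -> b <= l -> l + beta / 8 <= 5 * b ->
  concentrated b l -> concentrated b (- l) ->
  \int[prior b]_t Rk t <= D / b ->
  bounded_measurable h -> 0 <= tau <= 1 ->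
  (forall t, h t - (l * r t - b * Rk t) <= tau * Z (- l) t + 3 / 2 * Phi) ->
  ln (\int[posterior l]_t expR (h t)) <= 4 * D + 2 * K + 3 * Phi.
Proof.
move=> b0 bl lb devp devn RD bh tau01 hg.
have bg : bounded_measurable (fun t => l * r t - b * Rk t).
  by apply: bmB; exact: bmZ.
have h12 t : - (b * E t) - - (l * e t) =
    l * r t - b * Rk t + (l * ce - b * cE) by rewrite eE EE; ring.
have := gibbs_ln_expR_dev (bmN (bmZ b bE)) (bmN (bmZ l be)) bg bh (bZ (- l))
  h12 devn tau01 hg.
move=> /le_trans; apply.
rewrite RintB; [|exact: bmZ|exact: bmZ]; rewrite !RintZ//.
have := concentrated_mean_le devp.
move: RD; rewrite ler_pdivlMr// => RD.
have := Rint_ge0 (prior b).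
move: tau01 => /andP[_ tau1].
have : tau * K <= K by rewrite ler_piMl.
move: RD; set x := \int[_]_t Rk t; set y := \int[_]_t r t => RD tK x0 yx.
have : (l - b + beta / 8) * x <= 4 * b * x by apply: ler_wpM2r => //; lra.
lra.
Qed.

(** Against the more concentrated reference [prior (4 * beta)], the density of
    [posterior (2 * beta)] essentially increases with the risk, which forces the
    posterior to keep at least a fixed fraction of the reference excess risk.
    Scaling the deviation at level [gamma / 2] by [16 * beta / gamma] shrinks the
    error term by the same factor. *)
Lemma posterior_excess_ge :
  concentrated (4 * beta) (gamma / 2) ->
  concentrated (4 * beta) (- (gamma / 2)) ->
  gamma * \int[prior (4 * beta)]_t Rk t <=
  6 * gamma * \int[posterior (2 * beta)]_t r t + 30 * Phi + 20 * K.
Proof.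
move=> devp devn.
have g0 : 0 < gamma by move: beta_gt0 gamma_ge; lra.
(* [tau * (gamma / 2) = 8 * beta] outweighs the reference temperature
   [4 * beta], so that the coefficient of [Rk] in the exponent is positive. *)
pose tau := 16 * beta / gamma.
have tau01 : 0 <= tau <= 1.
  rewrite ler_pdivrMr// mul1r gamma_ge andbT divr_ge0 ?(ltW g0)//.
  by rewrite mulr_ge0 ?(ltW beta_gt0).
pose g t := 2 * beta * r t - 4 * beta * Rk t.
have bg : bounded_measurable g by apply: bmB; exact: bmZ.
have bh : bounded_measurable (fun t => tau * Z (- (gamma / 2)) t + g t).
  by apply: bmD => //; exact: bmZ.
have h12 t : - (4 * beta * E t) - - (2 * beta * e t) =
    g t + (2 * beta * ce - 4 * beta * cE) by rewrite eE EE /g; ring.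
have hg t : tau * Z (- (gamma / 2)) t + g t - g t <=
    tau * Z (- (gamma / 2)) t + 0 by rewrite addrK addr0.
have ub := gibbs_ln_expR_dev (bmN (bmZ (4 * beta) bE))
  (bmN (bmZ (2 * beta) be)) bg bh (bZ (- (gamma / 2))) h12 devn tau01 hg.
have := le_trans (Rint_le_ln_expR (posterior (2 * beta)) bh) ub.
have lb : \int[posterior (2 * beta)]_t
      (- (6 * beta) * r t - 3 / 2 * (tau * Phi)) <=
    \int[posterior (2 * beta)]_t (tau * Z (- (gamma / 2)) t + g t).
  apply: le_Rint => //.
    by apply: bmB; [exact: bmZ|exact: bm_cst].
  move=> t; rewrite /deviation /g.
  have taug : tau * gamma = 16 * beta by rewrite /tau divfK// gt_eqF.
  move: tau01 => /andP[tau0 tau1].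
  have := ler_wpM2l tau0 (margin_le t).
  have := mulr_ge0 tau0 (mulr_ge0 a_ge0 (m_ge0 t)).
  have : tau * (beta * Rk t) <= beta * Rk t.
    by rewrite ler_piMl// mulr_ge0// ltW.
  have : 0 <= beta * Rk t by rewrite mulr_ge0// ltW.
  have : tau * (- (gamma / 2) * (r t - Rk t)) = - (8 * beta) * (r t - Rk t).
    by rewrite mulNr mulrN !mulrA taug; field.
  rewrite !mulrDr; lra.
move=> /(le_trans lb).
rewrite RintB; [|exact: bmZ|exact: bm_cst]; rewrite RintZ// Rint_cst.
rewrite RintB; [|exact: bmZ|exact: bmZ]; rewrite !RintZ//.
have := concentrated_mean_le devp.
have := Rint_ge0 (prior (4 * beta)).
set x := \int[_]_t Rk t; set y := \int[_]_t r t; set z := \int[_]_t r t.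
move=> x0 dev bnd.
rewrite addr0 in bnd.
have bdev : 2 * beta * (gamma * (y - x)) <=
    4 * beta * (K + 3 / 2 * Phi + beta / 8 * x).
  by have := ler_wpM2l (ltW beta_gt0) dev; lra.
have taug : tau * gamma = 16 * beta by rewrite /tau divfK// gt_eqF.
have bndg := ler_wpM2r (ltW g0) bnd.
have tauK : tau * K * gamma = 16 * beta * K by rewrite mulrAC taug.
have tauPhi : tau * Phi * gamma = 16 * beta * Phi by rewrite mulrAC taug.
rewrite -(ler_pM2l beta_gt0).
have : 0 <= beta * (beta * x) by rewrite !mulr_ge0// ltW.
have : 16 * beta * (beta * x) <= gamma * (beta * x).
  by apply: ler_wpM2r => //; rewrite mulr_ge0// ltW.
move: bdev bndg tauK tauPhi; lra.
Qed.

End localized_comparison.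

(** * The empirical bound on a good sample *)

Section empirical_bound.
Context dX (X : measurableType dX) dY (Y : measurableType dY)
  dT (Theta : measurableType dT) (R : realType) (N : nat) (N_gt0 : (0 < N)%N).
Context (f : Theta -> X -> Y).
Context (Y_fin : finite_set [set: Y])
  (Y_discrete : forall S : set Y, measurable S)
  (f_meas : measurable_fun [set: Theta * X] (fun p => f p.1 p.2)).
Context (pi : probability Theta R) (th0 : Theta) (w : N.-tuple (X * Y)).

Local Notation posterior b := (gibbs pi (fun th => - (b * emp_risk R f w th))).

(** The triangle inequality through [th0] separates the two arguments of the
    empirical distance, and Jensen's inequality absorbs the averaged one. *)
Lemma log_dist_moment_le (rho : probability Theta R) (gamma lambda : R) :
  0 < gamma -> 4 * gamma <= N%:R ->
  log_dist_moment f pi w rho gamma lambda <=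
  ln (\int[rho]_th expR (gamma ^+ 2 / N%:R * emp_dist R f w th th0)) +
  ln (\int[posterior lambda]_th
        expR (gamma ^+ 2 / N%:R * emp_dist R f w th th0)).
Proof.
move=> g0 g4; rewrite /log_dist_moment.
set a := gamma ^+ 2 / N%:R; set c := N%:R * ln _.
have N0R : 0 < N%:R :> R by rewrite ltr0n.
have [c0 ca] : 0 <= c /\ c <= a.
  have x0 : 0 <= gamma / N%:R by rewrite divr_ge0 ?ltW.
  have x4 : 4 * (gamma / N%:R) <= 1 by rewrite mulrA ler_pdivrMr// mul1r.
  have /andP[l0 l1] := ln_cosh_le x0 x4; split; first exact: mulr_ge0.
  apply: (le_trans (ler_wpM2l (ltW N0R) l1)); rewrite le_eqVlt; apply/orP; left.
  by apply/eqP; rewrite /a; field; rewrite gt_eqF.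
have bd th : bounded_measurable (fun t => emp_dist R f w t th).
  exact: bm_emp_dist.
pose D th' := \int[rho]_th emp_dist R f w th th'.
have bD : bounded_measurable D.
  apply: (@bm_Rint _ _ _ _ _ rho (fun th' th => emp_dist R f w th th')).
    exact: bm_emp_dist.
  by move=> *; exact: emp_dist_ge0.
have D_le th' : D th' <= D th0 + emp_dist R f w th' th0.
  rewrite -[X in _ + X](Rint_cst rho) -RintD//; last exact: bm_cst.
  apply: le_Rint => //; first by apply: bmD => //; exact: bm_cst.
  by move=> t; exact: emp_dist_triangle.
have aD : a * D th0 <= ln (\int[rho]_th expR (a * emp_dist R f w th th0)).
  by rewrite -RintZ//; apply: Rint_le_ln_expR; exact: bmZ.
apply: (@le_trans _ _ (ln (\int[posterior lambda]_th
    (expR (a * D th0) * expR (a * emp_dist R f w th th0))))).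
  rewrite ler_ln ?posrE ?Rint_expR_gt0//; last 2 first.
  - exact: bmZ.
  - rewrite RintZ; last by apply: bm_expR; exact: bmZ.
    by rewrite mulr_gt0 ?expR_gt0 ?Rint_expR_gt0//; exact: bmZ.
  apply: le_Rint.
  - by apply: bm_expR; exact: bmZ.
  - by apply: bmZ; apply: bm_expR; exact: bmZ.
  move=> t; rewrite -expRD ler_expR -mulrDr.
  apply: le_trans (ler_wpM2l c0 (D_le t)) _; apply: ler_wpM2r => //.
  rewrite addr_ge0 ?emp_dist_ge0//; apply: Rintegral_ge0 => *.
  exact: emp_dist_ge0.
rewrite RintZ; last by apply: bm_expR; exact: bmZ.
rewrite lnM ?posrE ?expR_gt0 ?Rint_expR_gt0//; last exact: bmZ.
by rewrite expRK lerD2r.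
Qed.

End empirical_bound.

Section good_sample.
Context dX (X : measurableType dX) dY (Y : measurableType dY)
  dT (Theta : measurableType dT) (R : realType) (N : nat) (N_gt0 : (0 < N)%N).
Context (f : Theta -> X -> Y).
Context (Y_fin : finite_set [set: Y])
  (Y_discrete : forall S : set Y, measurable S)
  (f_meas : measurable_fun [set: Theta * X] (fun p => f p.1 p.2)).
Context (P_ : 'I_N -> probability (X * Y)%type R)
  (P : probability (N.-tuple (X * Y)) R) (P_prod : is_product_measure P_ P).
Context (pi : probability Theta R) (th0 : Theta)
  (th0_min : forall th, risk f P th0 <= risk f P th).
Context (w : N.-tuple (X * Y)).

Local Notation r := (fun th => emp_risk R f w th - emp_risk R f w th0).
Local Notation Rk := (fun th => risk f P th - risk f P th0).
Local Notation m := (emp_dist R f w ^~ th0).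
Local Notation M := (exp_dist f P ^~ th0).
Local Notation prior b := (gibbs pi (fun th => - (b * risk f P th))).
Local Notation posterior b := (gibbs pi (fun th => - (b * emp_risk R f w th))).

Context (beta gamma K Phi D : R).
Local Notation a := (gamma ^+ 2 / N%:R).
Local Notation concentrated b s :=
  (\int[prior b]_th expR (deviation r Rk m M a s th) <= expR K).

Context (beta_gt0 : 0 < beta) (gamma_ge : 16 * beta <= gamma)
  (gamma_le : 4 * gamma <= N%:R) (K_ge0 : 0 <= K) (Phi_ge0 : 0 <= Phi)
  (D_ge0 : 0 <= D).
Context (margin_le : forall th, 3 * a * M th <= 3 / 2 * Phi + beta / 8 * Rk th).
Context (high_pos : concentrated (gamma / 8) (gamma / 2))
  (high_neg : concentrated (gamma / 8) (- (gamma / 2)))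
  (low_pos : concentrated beta (2 * beta))
  (low_neg : concentrated beta (- (2 * beta)))
  (mid_pos : concentrated (4 * beta) (gamma / 2))
  (mid_neg : concentrated (4 * beta) (- (gamma / 2))).
Context (high_mean : \int[prior (gamma / 8)]_th Rk th <= D / (gamma / 8))
  (low_mean : \int[prior beta]_th Rk th <= D / beta).

Let gamma_gt0 : 0 < gamma.
Proof. by apply: lt_le_trans gamma_ge; rewrite mulr_gt0. Qed.

Let a_ge0 : 0 <= a.
Proof. by rewrite divr_ge0 ?sqr_ge0. Qed.

Let eE th : emp_risk R f w th = r th + emp_risk R f w th0.
Proof. by rewrite subrK. Qed.

Let EE th : risk f P th = Rk th + risk f P th0.
Proof. by rewrite subrK. Qed.

Let br : bounded_measurable r.
Proof. by apply: bmB; [exact: bm_emp_risk|exact: bm_cst]. Qed.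

Let bR : bounded_measurable Rk.
Proof. by apply: bmB; [exact: bm_risk P_prod|exact: bm_cst]. Qed.

Let bm : bounded_measurable m.
Proof. exact: bm_emp_dist. Qed.

Let bM : bounded_measurable M.
Proof. exact: bm_exp_dist. Qed.

Let Rk_ge0 th : 0 <= Rk th.
Proof. by rewrite subr_ge0. Qed.

Let m_ge0 th : 0 <= m th.
Proof. exact: emp_dist_ge0. Qed.

(** The common majorant of the logarithmic moments below. *)
Let T := 4 * D + 2 * K + 3 * Phi.

Let high_posterior tau h : bounded_measurable h -> 0 <= tau <= 1 ->
  (forall t, h t - (gamma / 2 * r t - gamma / 8 * Rk t) <=
     tau * deviation r Rk m M a (- (gamma / 2)) t + 3 / 2 * Phi) ->
  ln (\int[posterior (gamma / 2)]_t expR (h t)) <= T.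
Proof.
move=> bh tau01 hg; apply: (posterior_ln_expR_le eE EE br bR bm bM Rk_ge0 m_ge0
  a_ge0 K_ge0 margin_le _ _ _ high_pos high_neg high_mean bh tau01 hg).
- by rewrite divr_gt0.
- by move: gamma_gt0; lra.
- by move: gamma_gt0 gamma_ge; lra.
Qed.

Let facts th : [/\ 0 <= a * m th, 0 <= beta * Rk th &
  16 * beta * Rk th <= gamma * Rk th].
Proof.
by split; [exact: mulr_ge0|exact: mulr_ge0 (ltW beta_gt0) _|exact: ler_wpM2r].
Qed.

Lemma high_posterior_risk_le :
  gamma / 4 * \int[posterior (gamma / 2)]_th Rk th <= T.
Proof.
rewrite -RintZ//; apply: le_trans (Rint_le_ln_expR _ _) _; first exact: bmZ.
apply: (@high_posterior 1); [exact: bmZ|by rewrite ler01 lexx|].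
move=> t; rewrite /deviation; have [] := facts t; have := margin_le t.
by move: Phi_ge0; lra.
Qed.

Lemma high_posterior_emp_risk_le :
  gamma / 4 * \int[posterior (gamma / 2)]_th r th <= T.
Proof.
rewrite -RintZ//; apply: le_trans (Rint_le_ln_expR _ _) _; first exact: bmZ.
(* [h - g] contains [- (gamma / 4) * r], half of what the deviation controls. *)
apply: (@high_posterior (1 / 2)); [exact: bmZ|by apply/andP; split; lra|].
move=> t; rewrite /deviation; have [] := facts t; have := margin_le t.
by move: Phi_ge0; lra.
Qed.

Lemma high_posterior_dist_le :
  ln (\int[posterior (gamma / 2)]_th expR (a * m th)) <= T.
Proof.
apply: (@high_posterior 1); [exact: bmZ|by rewrite ler01 lexx|].
move=> t; rewrite /deviation; have [] := facts t; have := margin_le t.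
by move: Phi_ge0; lra.
Qed.

Lemma low_posterior_dist_le :
  ln (\int[posterior (2 * beta)]_th expR (a * m th)) <= T.
Proof.
apply: (posterior_ln_expR_le eE EE br bR bm bM Rk_ge0 m_ge0
  a_ge0 K_ge0 margin_le _ _ _ low_pos low_neg low_mean _ (tau := 1)) => //.
- by move: beta_gt0; lra.
- by move: beta_gt0; lra.
- exact: bmZ.
- by rewrite ler01 lexx.
move=> t; rewrite /deviation; have [] := facts t; have := margin_le t.
by move: Phi_ge0; lra.
Qed.

Lemma low_posterior_emp_risk_ge :
  gamma * \int[prior (4 * beta)]_th Rk th <=
  6 * gamma * \int[posterior (2 * beta)]_th r th + 30 * Phi + 20 * K.
Proof.
exact: (posterior_excess_ge eE EE br bR bm bM Rk_ge0 m_ge0 beta_gt0 gamma_ge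
  a_ge0 margin_le mid_pos mid_neg).
Qed.

(** Taking [gamma / 2] and [2 * beta] for the two free temperatures cancels the
    divergence term and leaves the two posteriors compared above. *)
Lemma Bfun_le0 (nu : probability (measurableTypeR R) R) (eps : R) :
  fine (nu [set beta]) != 0 -> fine (nu [set gamma]) != 0 ->
  0 <= - ln (eps * fine (nu [set beta]) * fine (nu [set gamma])) <= K ->
  24 * D + 16 * K + 21 * Phi <=
    gamma / 12 * \int[prior (4 * beta)]_th Rk th ->
  (Bfun f pi nu eps w (posterior (gamma / 2)) beta gamma <= 0)%E.
Proof.
move=> nb ng /andP[k0 kK] gain; rewrite /Bfun beta_gt0 gamma_gt0 nb ng /=.
have N0R : 0 < N%:R :> R by rewrite ltr0n.
have x0 : 0 <= gamma / N%:R by rewrite divr_ge0// ltW.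
have x4 : 4 * (gamma / N%:R) <= 1 by rewrite mulrA ler_pdivrMr// mul1r.
have th := tanh_ge x0 x4.
have t0 : 0 < tanh (gamma / N%:R).
  by apply: lt_le_trans th; rewrite mulr_gt0// divr_gt0.
apply: (@le_trans _ _
    (KL (posterior (gamma / 2)) (posterior (gamma / 2)) + _)%E).
  apply: ereal_inf_lbound; exists (gamma / 2, 2 * beta); last by [].
  split => /=; first by apply/andP; split; move: gamma_gt0; lra.
  rewrite ltr_pdivrMr//.
  have b2 : 0 <= 2 * beta by rewrite mulr_ge0// ltW.
  have : 0 < gamma / N%:R * beta by rewrite mulr_gt0// divr_gt0.
  by have := ler_wpM2r b2 th; lra.
rewrite KL_refl add0e lee_fin.
have -> : gamma - gamma / 2 = gamma / 2 by field.
have -> : beta / (2 * beta) = 1 / 2 by field; rewrite gt_eqF.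
have -> : beta * gamma / (2 * beta) = gamma / 2 by field; rewrite gt_eqF.
set k := ln _ in k0 kK *.
have dh := high_posterior_dist_le; have dl := low_posterior_dist_le.
have T0 : 0 <= T by move: D_ge0 K_ge0 Phi_ge0; rewrite /T; lra.
have lh := log_dist_moment_le N_gt0 Y_fin Y_discrete f_meas pi th0 w
  (posterior (gamma / 2)) (gamma / 2) gamma_gt0 gamma_le.
have ll := log_dist_moment_le N_gt0 Y_fin Y_discrete f_meas pi th0 w
  (posterior (2 * beta)) (2 * beta) gamma_gt0 gamma_le.
have F := @Fga_inv_le R N gamma (gamma / 2)
  (log_dist_moment f pi w (posterior (2 * beta)) gamma (2 * beta) - k)
  (2 * T + K) N_gt0 gamma_gt0 gamma_le (lexx _) _ _.
have {}F : gamma / 4 * Fga_inv N gamma (gamma / 2)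
    (log_dist_moment f pi w (posterior (2 * beta)) gamma (2 * beta) - k) <=
  2 * T + K.
  have g4 : 0 <= gamma / 4 by rewrite divr_ge0// ltW.
  apply: le_trans (ler_wpM2l g4 (F _ _)) _.
  - by lra.
  - by move: K_ge0; lra.
  by rewrite le_eqVlt; apply/orP; left; apply/eqP; field; rewrite gt_eqF.
have rE b : \int[posterior b]_t emp_risk R f w t =
    \int[posterior b]_t r t + emp_risk R f w th0.
  by rewrite RintB ?Rint_cst ?subrK//; [exact: bm_emp_risk|exact: bm_cst].
rewrite !rE.
have := high_posterior_emp_risk_le; have := low_posterior_emp_risk_ge.
move: F; set F := Fga_inv _ _ _ _.
set L1 := log_dist_moment _ _ _ _ _ _ in lh *.
set y := \int[_]_t r t; set z := \int[_]_t r t.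
set x := \int[_]_t Rk t in gain *.
move: D_ge0 K_ge0 Phi_ge0; rewrite /T in dh dl *.
lra.
Qed.

End good_sample.

(** * The margin function *)

Section margin.
Context dX (X : measurableType dX) dY (Y : measurableType dY)
  dT (Theta : measurableType dT) (R : realType) (N : nat).
Context (f : Theta -> X -> Y).
Context (Y_fin : finite_set [set: Y])
  (Y_discrete : forall S : set Y, measurable S)
  (f_meas : measurable_fun [set: Theta * X] (fun p => f p.1 p.2)).
Context (P_ : 'I_N -> probability (X * Y)%type R)
  (P : probability (N.-tuple (X * Y)) R) (P_prod : is_product_measure P_ P).

Lemma exp_dist_le_margin th0 th x :
  exp_dist f P th th0 <= margin f P th0 x + x * (risk f P th - risk f P th0).
Proof.
rewrite -lerBlDr; apply: ub_le_sup; last by exists th.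
have [_ [M MD]] := bm_exp_dist Y_fin Y_discrete f_meas P th0.
have [_ [L LD]] := bmZ x (bmB (bm_risk Y_fin Y_discrete f_meas P_prod)
  (bm_cst Theta (risk f P th0))).
exists (M + L) => _ [t _ <-].
have := le_trans (ler_norm _) (MD t).
by have := LD t; rewrite ler_norml => /andP[]; lra.
Qed.

Lemma margin_ge0 th0 x : 0 <= margin f P th0 x.
Proof.
have := exp_dist_le_margin th0 th0 x; rewrite subrr mulr0 addr0.
by apply: le_trans; apply: Rintegral_ge0 => *; exact: emp_dist_ge0.
Qed.

End margin.

(** * Temperature grid and temperature regime *)

Section grid.
Context (R : realType) (N : nat) (alpha : R).

Let L : R := ln N%:R / ln alpha.
Context (L_ge0 : 0 <= L).

Let powers : seq R := [seq alpha ^+ k | k <- iota 0 (Num.truncn L).+1].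

Let grid_powers b : grid N alpha b -> b \in powers.
Proof.
move=> [k /= kL <-]; apply/mapP; exists k => //.
by rewrite mem_iota /= add0n ltnS truncn_ge_nat// ltW.
Qed.

Lemma finite_grid : finite_set (grid N alpha).
Proof. exact: sub_finite_set grid_powers (finite_seq _). Qed.

Lemma card_grid_le : #|` fset_set (grid N alpha)|%:R <= L + 1.
Proof.
apply: (@le_trans _ _ (Num.truncn L).+1%:R).
  rewrite ler_nat -[X in (_ <= X)%N](size_iota 0).
  rewrite -(size_map (fun k => alpha ^+ k)).
  apply: uniq_leq_size; first exact: fset_uniq.
  move=> b; rewrite in_fset_set ?inE; first exact: grid_powers.
  exact: finite_grid.
by rewrite -natr1 lerD2r truncn_le.
Qed.

End grid.

Lemma uniform_on_atom (R : realType) (L : set R) (b : R) : finite_set L ->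
  L b -> fine (uniform_on L [set b]) = #|` fset_set L|%:R^-1.
Proof.
move=> fL Lb; set s := fset_set L; set n := #|` s|.
have bs : b \in s by rewrite in_fset_set// inE.
have n0 : (0 < n)%N by rewrite cardfs_gt0; apply/fset0Pn; exists b.
pose m : {measure set (measurableTypeR R) -> \bar R} :=
  msum (fun k => \d_(nth 0 s k : measurableTypeR R)) n.
have mE A : m A = (\sum_(k < n) \1_A (nth 0 s k))%:E.
  by rewrite /m /= /msum -sumEFin.
rewrite (_ : uniform_on L [set b] =
  mnormalize m \d_(0 : measurableTypeR R) [set b])//.
rewrite /mnormalize (mE setT) (eq_bigr (fun=> 1)); last first.
  by move=> i _; rewrite indicE mem_set.
rewrite sumr_const card_ord eqe pnatr_eq0 gtn_eqF//= mE.
have ib : (index b s < n)%N by rewrite index_mem.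
rewrite (bigD1 (Ordinal ib))//= big1 => [|i ii].
  by rewrite nth_index// addr0 indicE mem_set// mul1r.
rewrite indicE memNset//= => e; move/eqP: ii; apply.
by apply/val_inj => /=; rewrite -e index_uniq// fset_uniq.
Qed.

(** If [beta = alpha ^+ j] and [gamma = alpha ^+ k] with [j < k] then
    [alpha ^+ 2] is at most [gamma ^+ 2 / beta], hence at most [N]. This is what
    makes [ln L] bounded below, so that it can absorb numerical constants. *)
Lemma grid_log_ratio_ge2 (R : realType) (N : nat) (alpha beta gamma : R) :
  1 < alpha -> grid N alpha beta -> grid N alpha gamma ->
  beta < gamma -> gamma ^+ 2 <= beta * N%:R -> 2 <= ln N%:R / ln alpha.
Proof.
move=> a1 [j _ <-] [k _ <-] bg g2.
have jk : (j < k)%N by rewrite -(ltr_eXn2l a1).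
have a0 : 0 < alpha by apply: lt_trans a1.
have aN : alpha ^+ 2 <= N%:R.
  rewrite -(ler_pM2l (exprn_gt0 j a0)); apply: le_trans g2.
  rewrite -exprD -exprM ler_eXn2l//.
  case: k jk {bg} => // k; rewrite ltnS muln2 doubleS -addnn addn2 !ltnS => jk.
  by rewrite (leq_trans jk)// leq_addr.
have ln0 : 0 < ln alpha by rewrite ln_gt0.
rewrite ler_pdivlMr//.
have -> : 2 * ln alpha = ln (alpha ^+ 2) by rewrite lnXn// mulr_natl.
by rewrite ler_ln ?posrE ?exprn_gt0// (lt_le_trans _ aN) ?exprn_gt0.
Qed.

(** The number of grid points exceeds [L] by at most one; above [2] this and the
    factor six are absorbed in a power of [L]. *)
Lemma ln_union_size_le (R : realType) (n : nat) (L eps : R) :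
  (0 < n)%N -> n%:R <= L + 1 -> 2 <= L -> 0 < eps ->
  ln ((6 * n ^ 2)%:R / eps) <= 7 * ln L - ln eps.
Proof.
move=> n0 nL L2 e0; have L0 : 0 < L by lra.
rewrite ln_div ?posrE//; last by rewrite ltr0n muln_gt0 expn_gt0 n0.
rewrite lerD2r.
have -> : 7 * ln L = ln (L ^+ 7) by rewrite lnXn// mulr_natl.
rewrite ler_ln ?posrE ?exprn_gt0 ?ltr0n ?muln_gt0 ?expn_gt0 ?n0//.
rewrite natrM natrX -[7%N]/(3 + 4)%N exprD.
have L3 : 6 <= L ^+ 3.
  apply: (@le_trans _ _ (2 ^+ 3)); first by rewrite -natrX ler_nat.
  by rewrite ler_pXn2r ?nnegrE//; lra.
apply: ler_pM => //.
rewrite -[4%N]/(2 * 2)%N exprM ler_pXn2r ?nnegrE ?sqr_ge0//.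
by apply: (le_trans nL); rewrite expr2; nra.
Qed.

Lemma relative_error_bounds (R : realType) (b d delta y : R) :
  0 < b -> 0 < d -> `|b / d * y - 1| <= delta ->
  (1 - delta) * d / b <= y <= (1 + delta) * d / b.
Proof.
move=> b0 d0; rewrite ler_norml => /andP[h1 h2].
have -> : y = b / d * y * d / b by field; rewrite !gt_eqF.
by rewrite !ler_pM2r ?invr_gt0//; apply/andP; split; lra.
Qed.

Lemma ln_union_weight (R : realType) (n : nat) (eps : R) :
  (0 < n)%N -> 0 < eps -> eps < 1 ->
  0 <= - ln (eps * n%:R^-1 * n%:R^-1) <= ln ((6 * n ^ 2)%:R / eps).
Proof.
move=> n0 e0 e1; have n0R : 0 < n%:R :> R by rewrite ltr0n.
have n1 : 1 <= n%:R :> R by rewrite ler1n.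
rewrite -lnV ?posrE ?mulr_gt0 ?invr_gt0// !invfM !invrK.
have -> : eps^-1 * n%:R * n%:R = n%:R ^+ 2 / eps by rewrite expr2; ring.
rewrite natrM natrX; have n2 : 1 <= n%:R ^+ 2 :> R by rewrite exprn_ege1.
apply/andP; split.
  by apply: ln_ge0; rewrite ler_pdivlMr// mul1r; lra.
rewrite ler_ln ?posrE ?divr_gt0 ?exprn_gt0 ?mulr_gt0 ?exprn_gt0//.
by rewrite ler_pM2r ?invr_gt0//; lra.
Qed.

(** For [delta > 1] the upper bound on [beta / gamma] would be negative.
    Otherwise the first term of its denominator gives [16 * beta <= gamma], and
    multiplying out by [(1 - delta) * d] gives the last conclusion. *)
Lemma temperature_regime (R : realType) (c beta gamma n x d delta num : R) :
  16 <= c ->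
  0 < beta -> 0 < gamma -> 0 < n -> 0 < x -> 0 < d -> 0 < delta ->
  delta <> 1 -> 0 <= num ->
  gamma * Num.max x 1 / n <= 1 / 24 * beta / gamma ->
  beta / gamma <= 1 / (c * ((1 + delta) / (1 - delta)) +
                       num / ((1 - delta) * d)) ->
  [/\ [/\ delta < 1, 16 * beta <= gamma & 4 * gamma <= n],
      24 * gamma ^+ 2 <= beta * n,
      24 * (gamma ^+ 2 / n * x) <= beta &
      c * ((1 + delta) * d) + num <= gamma / beta * ((1 - delta) * d)].
Proof.
move=> c16 b0 g0 n0 x0 d0 e0 e1 num0 hx hb.
have c0 : 0 < c by lra.
have bg0 : 0 < beta / gamma by rewrite divr_gt0.
have dlt1 : delta < 1.
  rewrite ltNge le_eqVlt; apply/negP => /orP[/eqP/esym//|egt1].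
  move: hb; apply/negP; rewrite -ltNge; apply: le_lt_trans bg0.
  have d1 : 1 - delta <= 0 by lra.
  have : c * ((1 + delta) / (1 - delta)) <= 0.
    by rewrite pmulr_rle0// mulr_ge0_le0 ?invr_le0//; lra.
  have : num / ((1 - delta) * d) <= 0.
    by rewrite mulr_ge0_le0// invr_le0 mulr_le0_ge0// ltW.
  by rewrite mul1r invr_le0; lra.
have dd : 0 < (1 - delta) * d by rewrite mulr_gt0// subr_gt0.
have d1 : 0 < 1 - delta by rewrite subr_gt0.
have gain : c * ((1 + delta) * d) + num <= gamma / beta * ((1 - delta) * d).
  move: hb; set q := _ + _ => hb.
  have q0 : 0 < q.
    by rewrite ltr_wpDr ?divr_ge0 ?(ltW dd)// mulr_gt0// divr_gt0// addr_gt0.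
  have -> : c * ((1 + delta) * d) + num = q * ((1 - delta) * d).
    by rewrite /q; field; rewrite !gt_eqF.
  rewrite ler_wpM2r ?(ltW dd)// -[gamma / beta]invf_div.
  by rewrite -[leLHS]invrK lef_pV2 ?posrE ?invr_gt0// -[leRHS]mul1r.
have b16 : 16 * beta <= gamma.
  have h : 16 * ((1 - delta) * d) <= gamma / beta * ((1 - delta) * d).
    apply: le_trans gain.
    have h1 : (1 - delta) * d <= (1 + delta) * d.
      by rewrite ler_wpM2r ?(ltW d0)//; lra.
    have := ler_wpM2r (le_trans (ltW dd) h1) c16; lra.
  by move: h; rewrite ler_pM2r// ler_pdivlMr.
have mx1 : 1 <= Num.max x 1 by rewrite le_max lexx orbT.
have mxx : x <= Num.max x 1 by rewrite le_max lexx.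
have gmx : 24 * (gamma ^+ 2 * Num.max x 1) <= beta * n.
  move: hx; rewrite ler_pdivrMr// mulrAC ler_pdivlMr// => hx.
  have -> : gamma ^+ 2 * Num.max x 1 = gamma * Num.max x 1 * gamma by ring.
  lra.
have g2 : 0 < gamma ^+ 2 by rewrite exprn_gt0.
have h1 : gamma ^+ 2 <= gamma ^+ 2 * Num.max x 1 by rewrite ler_peMr// ltW.
have h2 : gamma ^+ 2 * x <= gamma ^+ 2 * Num.max x 1 by rewrite ler_wpM2l// ltW.
split => //.
- split => //.
  have : 24 * gamma ^+ 2 <= gamma * n.
    apply: (@le_trans _ _ (beta * n)); first lra.
    by rewrite ler_wpM2r ?(ltW n0)//; lra.
  by rewrite expr2 mulrCA ler_pM2l//; lra.
- lra.
- by rewrite mulrAC mulrA ler_pdivrMr//; lra.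
Qed.

Theorem theorem1p50 (R : realType) :
  exists A B1 B2 B3 B4 : R,
    [/\ 0 < A, 0 < B1, 0 < B2, 0 < B3 & 0 < B4] /\
  forall (N : nat) (N_ge1 : (1 <= N)%N)
    (dX : measure_display) (X : measurableType dX)
    (dY : measure_display) (Y : measurableType dY)
    (dT : measure_display) (Theta : measurableType dT)
    (X_cg : countably_generated X) (Theta_cg : countably_generated Theta)
    (Y_fin : finite_set [set: Y]) (Y_discrete : forall S : set Y, measurable S)
    (f : Theta -> X -> Y)
    (f_meas : measurable_fun [set: Theta * X] (fun p => f p.1 p.2))
    (P_ : 'I_N -> probability (X * Y)%type R)
    (P : probability (N.-tuple (X * Y)) R)
    (P_prod : is_product_measure P_ P)
    (theta0 : Theta)
    (theta0_min : risk f P theta0 = inf (range (risk f P)))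
    (eps : R) (eps_gt0 : 0 < eps) (eps_lt1 : eps < 1)
    (alpha d delta : R) (alpha_gt1 : 1 < alpha)
    (* for alpha > N the grid is {1} and the bound below is positive *)
    (alpha_leN : alpha <= N%:R)
    (d_gt0 : 0 < d) (delta_gt0 : 0 < delta) (delta_neq1 : delta <> 1)
    (pi : probability Theta R),
  exists E : set (N.-tuple (X * Y)),
    [/\ measurable E, ((1 - eps)%:E <= P E)%E &
    forall w, E w ->
    forall beta gamma : R, grid N alpha beta -> grid N alpha gamma ->
    let pi_R b := gibbs pi (fun theta => - (b * risk f P theta)) in
    let rho := gibbs pi (fun theta => - (gamma / 2 * emp_risk R f w theta)) in
    let nu := uniform_on (grid N alpha) in
    let infR := inf (range (risk f P)) in
    (ereal_sup [set `| b / d * (\int[pi_R b]_theta risk f P theta - infR) - 1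
                     |%:E | b in [set b : R | (beta <= b)%R]]
       <= delta%:E)%E ->
    (exists x : R,
      [/\ 0 < x,
          gamma * Num.max x 1 / N%:R <= A * beta / gamma &
          beta / gamma <=
            B1 / (B2 * ((1 + delta) / (1 - delta)) +
                  (B4 * (gamma ^+ 2 / N%:R) * margin f P theta0 x
                   - 2 * B3 * ln eps
                   + 4 * B3 * ln (ln N%:R / ln alpha)) / ((1 - delta) * d))]) ->
    [/\ (Bfun f pi nu eps w rho beta gamma <= 0)%E,
        (beta%:E <= beta_hat f pi nu eps w rho)%E,
        \int[rho]_theta risk f P theta <=
          \int[pi_R beta]_theta risk f P theta &
        \int[pi_R beta]_theta risk f P theta <=
          infR + (1 + delta) * d / beta]].
Proof.
(* [posterior_excess_ge] guarantees the gain [gamma / 12] times the mean of the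
   excess risk at [4 * beta], that is 1/48 of
   [gamma / beta * ((1 - delta) * d)]; whence the common factor 48. The errors to
   be absorbed are [24 * D + 16 * K + 21 * Phi], where [Phi] is twice the margin
   term and [K <= 7 * ln L - ln eps], and 28 covers both [4 * 28 = 16 * 7] and
   [2 * 28 >= 16]. The constant [1 / 24] makes [3 * gamma ^+ 2 * x / N] at most
   [beta / 8]. *)
have [c c48] : exists c : R, c = 48 by exists 48.
exists (1 / 24), 1, (24 * c), (28 * c), (42 * c); split.
  by split; rewrite ?ltr01//; lra.
move=> N N_ge1 dX X dY Y dT Theta _ _ Y_fin Y_discrete f f_meas P_ P P_prod th0
  th0_min eps eps_gt0 eps_lt1 alpha d delta alpha_gt1 alpha_leN d_gt0 delta_gt0
  delta_neq1 pi.
have N0R : 0 < N%:R :> R by rewrite ltr0n.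
have lna0 : 0 < ln alpha by rewrite ln_gt0.
pose L := ln N%:R / ln alpha.
have L1 : 1 <= L.
  by rewrite ler_pdivlMr// mul1r ler_ln ?posrE// (lt_trans _ alpha_gt1).
have L0 : 0 <= L by clear -L1; lra.
pose G := fset_set (grid N alpha); pose n := #|` G|.
have fG := finite_grid L0.
have inG b : grid N alpha b -> b \in (G : seq R).
  by move=> Gb; have := in_fset_set fG b; rewrite mem_set.
have n0 : (0 < n)%N.
  rewrite cardfs_gt0; apply/fset0Pn; exists 1; apply: inG; exists 0%N => //=.
  by apply: lt_le_trans L1.
have nL : n%:R <= L + 1 by exact: card_grid_le L0.
pose K := ln ((6 * n ^ 2)%:R / eps).
have n6 : 0 < (6 * n ^ 2)%:R :> R by rewrite ltr0n muln_gt0 expn_gt0 n0.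
have [E [mE PE E_good]] :=
  good_event N_ge1 Y_fin Y_discrete f_meas P_prod pi th0 (G : seq R) K.
exists E; split => //.
  apply: le_trans PE; rewrite lee_fin lerD2l lerN2 expRN lnK ?posrE ?divr_gt0//.
  by rewrite invf_div mulrCA divff ?mulr1// gt_eqF.
move=> w Ew beta gamma Gb Gg /= hsup [x [x0 hx hb]].
have b0 : 0 < beta.
  by case: Gb => j _ <-; rewrite exprn_gt0// (lt_trans _ alpha_gt1).
have g0 : 0 < gamma.
  by case: Gg => j _ <-; rewrite exprn_gt0// (lt_trans _ alpha_gt1).
set phi := margin f P th0 x in hb.
have phi0 : 0 <= phi by exact: (margin_ge0 Y_fin Y_discrete f_meas P_prod).
have lneps : ln eps <= 0 by apply: ln_le0; exact: ltW.
have lnL : 0 <= ln L by rewrite ln_ge0.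
set num := (X in X / ((1 - delta) * d)) in hb.
have a0 : 0 <= gamma ^+ 2 / N%:R by rewrite divr_ge0 ?sqr_ge0.
have numE : num =
    c * (42 * (gamma ^+ 2 / N%:R * phi) - 56 * ln eps + 112 * ln L).
  by rewrite /num -/L; ring.
have num0 : 0 <= num.
  rewrite numE; apply: mulr_ge0; first by rewrite c48.
  by have := mulr_ge0 a0 phi0; move: lneps lnL; clear; lra.
have c16 : 16 <= 24 * c by clear -c48; lra.
have [[dlt1 b16 g4] gg gx gain] := temperature_regime c16 b0 g0 N0R x0 d_gt0
  delta_gt0 delta_neq1 num0 hx hb.
have L2 : 2 <= L.
  apply: (grid_log_ratio_ge2 alpha_gt1 Gb Gg); first by clear -b0 b16; lra.
  by have := sqr_ge0 gamma; clear -gg; lra.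
have KL := ln_union_size_le n0 nL L2 eps_gt0.
rewrite -/K in KL.
pose Rk th := risk f P th - risk f P th0.
have bR : bounded_measurable (risk f P) by exact: bm_risk P_prod.
have th0_le th : risk f P th0 <= risk f P th.
  rewrite th0_min; apply: ge_inf; last by exists th.
  have [_ [M MR]] := bR; exists (- M) => _ [t _ <-].
  by have := MR t; rewrite ler_norml => /andP[].
have meanE (mu : probability Theta R) :
    \int[mu]_th Rk th = \int[mu]_th risk f P th - risk f P th0.
  by rewrite /Rk RintB ?Rint_cst//; exact: bm_cst.
have conc b : beta <= b -> (1 - delta) * d / b <=
    \int[gibbs pi (fun th => - (b * risk f P th))]_th Rk th <=
    (1 + delta) * d / b.
  move=> bb; have bpos : 0 < b by apply: lt_le_trans bb.
  have : `|b / d * (\int[gibbs pi (fun th => - (b * risk f P th))]_th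
      risk f P th - inf (range (risk f P))) - 1| <= delta.
    rewrite -lee_fin; apply: le_trans hsup; apply: ereal_sup_ubound.
    by exists b.
  by rewrite -th0_min -meanE; exact: relative_error_bounds.
pose Phi := 2 * (gamma ^+ 2 / N%:R * phi).
pose D := (1 + delta) * d.
have Phi0 : 0 <= Phi by exact: mulr_ge0 (ler0n R 2) (mulr_ge0 a0 phi0).
have D0 : 0 <= D.
  exact: mulr_ge0 (addr_ge0 ler01 (ltW delta_gt0)) (ltW d_gt0).
have K0 : 0 <= K.
  by have /andP[] := ln_union_weight n0 eps_gt0 eps_lt1; exact: le_trans.
have Rk0 th : 0 <= Rk th by rewrite subr_ge0.
have margin_le th : 3 * (gamma ^+ 2 / N%:R) * exp_dist f P th th0 <=
    3 / 2 * Phi + beta / 8 * Rk th.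
  have := ler_wpM2l a0
    (exp_dist_le_margin Y_fin Y_discrete f_meas P_prod th0 th x).
  have := ler_wpM2r (Rk0 th) gx; rewrite -/phi /Phi -/(Rk th).
  clear; lra.
have dev b s := E_good w Ew beta gamma (inG _ Gb) (inG _ Gg) b0 b16 g4 b s.
have c1 := dev (gamma / 8) (gamma / 2) ltac:(by rewrite !inE eqxx ?orbT).
have c2 := dev (gamma / 8) (- (gamma / 2)) ltac:(by rewrite !inE eqxx ?orbT).
have c3 := dev beta (2 * beta) ltac:(by rewrite !inE eqxx ?orbT).
have c4 := dev beta (- (2 * beta)) ltac:(by rewrite !inE eqxx ?orbT).
have c5 := dev (4 * beta) (gamma / 2) ltac:(by rewrite !inE eqxx ?orbT).
have c6 := dev (4 * beta) (- (gamma / 2)) ltac:(by rewrite !inE eqxx ?orbT).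
have /andP[_ m1] : _ <= _ <= _ := conc (gamma / 8) ltac:(clear -b0 b16; lra).
have /andP[l2 m2] : _ <= _ <= _ := conc beta (lexx _).
have /andP[l3 _] : _ <= _ <= _ := conc (4 * beta) ltac:(clear -b0; lra).
have atomE b : grid N alpha b ->
    fine (uniform_on (grid N alpha) [set b]) = n%:R^-1.
  by move=> Gb'; rewrite uniform_on_atom.
have n0R : 0 < n%:R :> R by rewrite ltr0n.
have gainR : 48 * (24 * D + (42 * (gamma ^+ 2 / N%:R * phi) - 56 * ln eps +
    112 * ln L)) <= gamma / beta * ((1 - delta) * d).
  by apply: le_trans gain; rewrite -c48 le_eqVlt; apply/orP; left; apply/eqP;
    rewrite numE /D; ring.
clear gain hb num numE num0 hx.
have BL : (Bfun f pi (uniform_on (grid N alpha)) eps w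
    (gibbs pi (fun th => - (gamma / 2 * emp_risk R f w th)%R)%R) beta gamma
    <= 0)%E.
  apply: (@Bfun_le0 _ _ _ _ _ _ _ _ N_ge1 _ Y_fin Y_discrete f_meas _ _ P_prod
    _ _ th0_le w beta gamma K Phi D) => //.
  - by rewrite atomE// invr_eq0 gt_eqF.
  - by rewrite atomE// invr_eq0 gt_eqF.
  - by rewrite !atomE//; exact: ln_union_weight.
  apply: (@le_trans _ _ (gamma / 12 * ((1 - delta) * d / (4 * beta)))).
    have -> : gamma / 12 * ((1 - delta) * d / (4 * beta)) =
        gamma / beta * ((1 - delta) * d) / 48 by field; rewrite gt_eqF.
    by rewrite ler_pdivlMr// /Phi; clear -gainR KL lneps lnL; lra.
  by rewrite ler_wpM2l// divr_ge0// ltW.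
have last : \int[gibbs pi (fun th => - (beta * risk f P th))]_th risk f P th <=
    inf (range (risk f P)) + (1 + delta) * d / beta.
  by move: m2; rewrite meanE -th0_min; clear; lra.
split => //.
- apply: ereal_sup_ubound; exists beta => //=.
  apply: le_trans BL; apply: ereal_inf_lbound; exists gamma => //=.
  have x4 : 4 * (gamma / N%:R) <= 1 by rewrite mulrA ler_pdivrMr// mul1r.
  have := tanh_ge (divr_ge0 (ltW g0) (ltW N0R)) x4.
  move=> /(ler_wpM2l (ltW N0R)); apply: lt_le_trans.
  rewrite (_ : N%:R * _ = 3 / 4 * gamma); last by field; rewrite gt_eqF.
  by clear -b0 b16; lra.
- have := @high_posterior_risk_le _ _ _ _ _ _ _ _ _ Y_fin Y_discrete f_meas
    _ _ P_prod pi _ th0_le w beta gamma K Phi D b0 b16 K0 Phi0 margin_le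
    c1 c2 m1.
  rewrite -/(Rk _) meanE => hp; move: l2; rewrite meanE => l2.
  rewrite -(lerD2r (- risk f P th0)); apply: le_trans l2.
  have g4' : 0 < gamma / 4 by rewrite divr_gt0.
  rewrite -(ler_pM2l g4'); apply: (le_trans hp).
  have -> : gamma / 4 * ((1 - delta) * d / beta) =
     gamma / beta * ((1 - delta) * d) / 4 by field; rewrite gt_eqF.
  rewrite ler_pdivlMr// /Phi; have := mulr_ge0 a0 phi0.
  by clear -gainR KL lneps lnL D0; lra.
Qed.
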